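(* Let $H$ be a Hilbert space, $U\subset H$ a closed linear subspace, $W\subset H$ a closed affine subspace with direction subspace $V$, and $u^{(0)}\in U$. Let $(u^{(n)})_{n\ge0}$ satisfy the recurrence $$r^{(n)}=u^{(n)}-P_UP_Wu^{(n)},\qquad p^{(n)}=-r^{(n)}+\beta_{n-1}p^{(n-1)},\qquad u^{(n+1)}=u^{(n)}+\alpha_np^{(n)},\qquad n\ge0,$$ with $\alpha_n=\|r^{(n)}\|^2/\|P_{V^\perp}p^{(n)}\|^2$ for $n\ge0$, $\beta_{n-1}=\|r^{(n)}\|^2/\|r^{(n-1)}\|^2$ for $n\ge1$, and $\beta_{-1}=0$ (so that $p^{(0)}=-r^{(0)}$). (i) If $M_{U,W}\neq\emptyset$, $u^{(n)}$ converges in norm to $P_{M_{U,W}}u^{(0)}$; if $M_{U,W}=\emptyset$, $\|u^{(n)}\|$ tends to $\infty$. (ii) If $\theta_{\mathrm f}=\theta_{\mathrm f}(U,V)>0$, then $M_{U,W}\neq\emptyset$ and the error $e^{(n)}:=u^{(n)}-P_{M_{U,W}}u^{(0)}$ satisfies $$\|e^{(n)}\|\le2\kappa\Big(1-\frac{2}{\kappa+1}\Big)^{n}\|e^{(0)}\|,\quad n\ge0,\qquad\text{where }\kappa:=\sin\theta_p/\sin\theta_{\mathrm f}.$$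
   Context: $P_S$ denotes the orthogonal projection onto a nonempty closed affine subspace $S$ of $H$. $M_{U,W}:=\{u\in U:\|u-P_Wu\|=\inf_{v\in U}\|v-P_Wv\|\}$. The angle $\theta_p=\theta_p(U,V)\in[0,\pi/2]$ is $\theta_p:=\arcsin\|P_UP_{V^\perp}\|$. The Friedrichs angle $\theta_{\mathrm f}=\theta_{\mathrm f}(U,V)\in[0,\pi/2]$ is defined by $\cos\theta_{\mathrm f}:=\sup\{|\langle u,v\rangle|:u\in U_0,\ v\in V_0,\ \|u\|=\|v\|=1\}$, where $U_0:=U\cap(U\cap V)^\perp$ and $V_0:=V\cap(U\cap V)^\perp$ (the supremum of the empty set being $0$). The iteration is terminated as soon as $r^{(n)}=0$, in which case the sequence is regarded as constant from then on ($u^{(m)}=u^{(n)}$ for $m\ge n$). *)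

(* Defs.v *)
From HB Require Import structures.
From mathcomp Require Import all_boot all_order all_algebra sesquilinear.
From mathcomp Require Import all_classical all_reals all_analysis.
From mathcomp Require Import complex.

Set Implicit Arguments.
Unset Strict Implicit.
Unset Printing Implicit Defensive.

Import Order.TTheory GRing.Theory Num.Theory.
Import numFieldNormedType.Exports.

Local Open Scope classical_set_scope.
Local Open Scope ring_scope.

(* A Hilbert space may be real or complex. The scalar field is selected by [k],
   and [scalar_re] brings norms and moduli, which take their values in the
   scalar field, back to the reals. *)
Variant scalar_kind := RealScalars | ComplexScalars.

Definition scalars (R : realType) (k : scalar_kind) : numFieldType :=
  match k with RealScalars => R | ComplexScalars => R[i] end.

Definition scalar_conj (R : realType) (k : scalar_kind) :
    involutive_rmorphism (scalars R k) :=
  match k with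
  | RealScalars => @idfun R
  | ComplexScalars => @Num.conj R[i]
  end.

Definition scalar_re (R : realType) (k : scalar_kind) : scalars R k -> R :=
  match k with
  | RealScalars => @idfun R
  | ComplexScalars => @complex.Re R
  end.

Section Hilbert.
Context {R : realType} {k : scalar_kind}.
Local Notation K := (scalars R k).

Definition rabs (a : K) : R := scalar_re `|a|.

Context {H : completeNormedModType K}.

Definition rnorm (x : H) : R := scalar_re `|x|.

Definition op_norm (T : H -> H) : R :=
  sup [set rnorm (T x) | x in [set x | rnorm x <= 1]].

Definition linear_subspace (U : set H) : Prop := submod_closed [in U].

Definition affine_subspace_with_direction (W V : set H) : Prop :=
  linear_subspace V /\ exists w, W = [set w + v | v in V].

Variable dot : {dot H for @scalar_conj R k}.

Definition orth (S : set H) : set H :=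
  [set x | forall s, S s -> dot x s = 0].

(* Meaningful when [S] is a nonempty closed affine subspace; the value for
   other sets is junk. *)
Definition orth_proj (S : set H) (x : H) : H :=
  xget x [set p | S p /\ forall s, S s -> dot (x - p) (s - p) = 0].

Definition minimizers (U W : set H) : set H :=
  [set u | U u /\ rnorm (u - orth_proj W u) = inf [set rnorm (v - orth_proj W v) | v in U]].

Definition theta_p (U V : set H) : R :=
  asin (op_norm (orth_proj U \o orth_proj (orth V))).

(* [sup set0 = 0], as required when there are no unit vectors in one of the
   two subspaces. *)
Definition friedrichs_angle (U V : set H) : R :=
  let U0 := U `&` orth (U `&` V) in
  let V0 := V `&` orth (U `&` V) in
  acos (sup [set c | exists u v,
    [/\ U0 u, V0 v, rnorm u = 1, rnorm v = 1 & c = rabs (dot u v)]]).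

(* The iteration stops at the first [n] with [r n = 0]; [u] is constant from
   then on, and the search directions [p m], [m >= n], are left unconstrained. *)
Definition cg_iteration (U W V : set H) (u0 : H) (u r p : nat -> H) : Prop :=
  [/\ u 0%N = u0,
      forall n, r n = u n - orth_proj U (orth_proj W (u n)),
      r 0%N != 0 -> p 0%N = - r 0%N,
      forall n, r n.+1 != 0 ->
        p n.+1 = - r n.+1 + (`|r n.+1| ^+ 2 / `|r n| ^+ 2) *: p n
    & forall n, u n.+1 =
        if r n == 0 then u n
        else u n + (`|r n| ^+ 2 / `|orth_proj (orth V) (p n)| ^+ 2) *: p n].

End Hilbert.

(* Main.v *)
Require Import Defs.
From HB Require Import structures.
From mathcomp Require Import all_boot all_order all_algebra sesquilinear.
From mathcomp Require Import all_classical all_reals all_analysis.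
From mathcomp Require Import complex ring lra.

Set Implicit Arguments.
Unset Strict Implicit.
Unset Printing Implicit Defensive.

Import Order.TTheory GRing.Theory Num.Theory.
Import numFieldNormedType.Exports.

Local Open Scope classical_set_scope.
Local Open Scope ring_scope.

(* Write [W = w + V] and let [Q] be the orthogonal projection onto the
   complement of [V]. With [B = Q P_U] and [b = Q w], minimising the distance
   from [u] in [U] to [W] is the least-squares problem [min |B u - b|], and the
   iteration is the conjugate gradient method for the normal equation
   [B* (B u - b) = 0]. Only real coefficients occur in it, so a complex [H] may
   be regarded as a real Hilbert space.

   (i) No spectral theory is needed. If [us] is a solution, every direction
   [p_m] makes an acute angle with the later errors [us - u_n], whence
   [|u_n - u_m|^2 <= |u_m - us|^2 - |u_n - us|^2]: the iterates form a Cauchy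
   sequence. The functional decreases by at least [|r_n|^2] in each step, so
   [r_n] tends to [0] and the limit solves the normal equation; it differs from
   [u_0] by a vector orthogonal to [ker B], so it is the projection of [u_0].
   Since [r_n] tends to [0] in any case, a bounded subsequence would give, by
   convexity and completeness, a solution.

   (ii) The iterate [u_n] minimises [|B (u - us)|] over a shifted Krylov space,
   so it beats the Chebyshev polynomial of [B* B], which is bounded on the
   spectral interval [[sin^2 theta_f, sin^2 theta_p]] by Pell's equation. *)

(** Evaluate at the minimiser [- b / c]; for [c = 0] the affine function would take the value [-1]
    somewhere unless [b = 0]. Allowing [c = 0] serves forms that are only semidefinite. *)
Lemma discriminant_le (R : realFieldType) (a b c : R) : 0 <= c ->
  (forall t, 0 <= a + 2 * t * b + t ^+ 2 * c) -> b ^+ 2 <= a * c.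
Proof.
rewrite le_eqVlt => /orP[/eqP <-|c_gt0] h.
  have [-> |b_neq0] := eqVneq b 0; first by rewrite expr0n mulr0.
  have := h (- (a + 1) / (2 * b)).
  have -> : a + 2 * (- (a + 1) / (2 * b)) * b + (- (a + 1) / (2 * b)) ^+ 2 * 0
    = - 1 by field.
  by rewrite ler0N1.
have := h (- b / c).
have -> : a + 2 * (- b / c) * b + (- b / c) ^+ 2 * c = (a * c - b ^+ 2) / c.
  by field; rewrite gt_eqF.
by rewrite pmulr_lge0 ?invr_gt0// subr_ge0.
Qed.

(** * Semi-inner products on real vector spaces *)

Section RealLinear.
Context {R : realType} {E : lmodType R}.
Variable B : E -> E.

Definition real_linear := forall a x y, B (a *: x + y) = a *: B x + B y.

Hypothesis B_lin : real_linear.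

Lemma rlinD x y : B (x + y) = B x + B y.
Proof. by rewrite -[x]scale1r B_lin !scale1r. Qed.

Lemma rlin0 : B 0 = 0.
Proof. by apply: (addrI (B 0)); rewrite -rlinD !addr0. Qed.

Lemma rlinZ a x : B (a *: x) = a *: B x.
Proof. by rewrite -[a *: x]addr0 B_lin rlin0 addr0. Qed.

Lemma rlinN x : B (- x) = - B x.
Proof. by rewrite -scaleN1r rlinZ scaleN1r. Qed.

End RealLinear.

Lemma scale_half_double (R : numFieldType) (E : lmodType R) (x : E) :
  2^-1 *: (x + x) = x.
Proof. by rewrite -mulr2n -[x *+ 2]scaler_nat scalerA mulVf ?scale1r. Qed.

Section SemiInnerProduct.
Context {R : realType} {E : lmodType R}.

(* Definiteness is left out: the energy [f (B x) (B y)] is an instance. *)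
Record semi_inner (f : E -> E -> R) : Prop := SemiInner {
  siC : forall x y, f x y = f y x;
  siDl : forall x y z, f (x + y) z = f x z + f y z;
  siZl : forall a x y, f (a *: x) y = a * f x y;
  si_ge0 : forall x, 0 <= f x x }.

Variable f : E -> E -> R.
Hypothesis fP : semi_inner f.

Lemma siDr x y z : f z (x + y) = f z x + f z y.
Proof. by rewrite (siC fP) siDl// !(siC fP z). Qed.

Lemma siZr a x y : f y (a *: x) = a * f y x.
Proof. by rewrite (siC fP) siZl// (siC fP y). Qed.

Lemma siNl x y : f (- x) y = - f x y.
Proof. by rewrite -scaleN1r siZl// mulN1r. Qed.

Lemma siNr x y : f y (- x) = - f y x.
Proof. by rewrite -scaleN1r siZr mulN1r. Qed.

Lemma si0l x : f 0 x = 0.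
Proof. by rewrite -(scale0r 0) siZl// mul0r. Qed.

Lemma si0r x : f x 0 = 0.
Proof. by rewrite (siC fP) si0l. Qed.

Definition siE := (siDl fP, siDr, siZl fP, siZr, siNl, siNr, si0l, si0r).

Lemma cauchy_schwarz x y : f x y ^+ 2 <= f x x * f y y.
Proof.
apply: discriminant_le => [|t]; first exact: si_ge0.
 have := si_ge0 fP (x + t *: y).
by rewrite !siE (siC fP y x); congr (0 <= _); ring.
Qed.

Lemma si_eq0l x y : f x x = 0 -> f x y = 0.
Proof.
move=> x0; apply/eqP; rewrite -sqrf_eq0 eq_le sqr_ge0 andbT.
by rewrite (le_trans (cauchy_schwarz x y))// x0 mul0r.
Qed.

(** [E] carries no topology, so convergence is expressed by squared distances. *)
Definition si_cvg (x : nat -> E) (l : E) :=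
  (fun n => f (x n - l) (x n - l)) @ \oo --> (0 : R).

Lemma si_cvg_formB x l y : si_cvg x l -> (fun n => f (x n - l) y) @ \oo --> 0.
Proof.
move=> xl; have h : (fun n => f (x n - l) y ^+ 2) @ \oo --> (0 : R).
  apply: (@squeeze_cvgr _ _ _ _ (cst 0)
    (fun n => f (x n - l) (x n - l) * f y y)).
  - by near=> n; rewrite sqr_ge0 cauchy_schwarz.
  - exact: cvg_cst.
  - by rewrite -(mul0r (f y y)); apply: cvgMl.
apply/cvgr0Pnorm_lt => e e0; have e2 : 0 < e ^+ 2 by rewrite exprn_gt0.
near=> n; rewrite -(@ltr_pXn2r _ 2)// ?nnegrE ?(ltW e0)//.
by rewrite -normrX; near: n; move/cvgr0Pnorm_lt: h; apply.
Unshelve. all: by end_near. Qed.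

Lemma si_cvg_form x l y : si_cvg x l -> (fun n => f (x n) y) @ \oo --> f l y.
Proof.
move=> /(si_cvg_formB y) xl; rewrite -(add0r (f l y)).
under eq_fun do rewrite -(subrK l (x _)) (siDl fP).
by apply: cvgD => //; apply: cvg_cst.
Qed.

Lemma si_cvg_sqr x l : si_cvg x l -> (fun n => f (x n) (x n)) @ \oo --> f l l.
Proof.
move=> xl.
have -> : (fun n => f (x n) (x n)) =
    (fun n => f (x n - l) (x n - l) + 2 * f (x n) l - f l l).
  by apply/funext => n; rewrite !siE (siC fP l); ring.
rewrite [X in _ --> X](_ : f l l = 0 + 2 * f l l - f l l); last by ring.
apply: cvgB; last exact: cvg_cst.
by apply: cvgD => //; apply: cvgM; [exact: cvg_cst|exact: si_cvg_form].
Qed.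

End SemiInnerProduct.

(** * Completeness, nested convex sets and orthogonal decomposition *)

Section Completeness.
Context {R : realType} {E : lmodType R}.
Variable f : E -> E -> R.
Hypothesis fP : semi_inner f.

(* Cauchy sequences are given with a modulus [e] for the squared distances. *)
Definition si_complete := forall (x : nat -> E) (e : nat -> R),
  e @ \oo --> (0 : R) ->
  (forall n m, (n <= m)%N -> f (x m - x n) (x m - x n) <= e n) ->
  exists l, si_cvg f x l.

Hypothesis f_complete : si_complete.

(* Almost minimal vectors [x n] of [S n] form a Cauchy sequence by the
   parallelogram law. *)
Lemma nested_convex_limit (S : nat -> set E) (C : R) :
  (forall n m, (n <= m)%N -> S m `<=` S n) ->
  (forall n x y, S n x -> S n y -> S n (2^-1 *: (x + y))) ->
  (forall n, exists2 x, S n x & f x x <= C) ->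
  exists x l, [/\ forall n, S n (x n), si_cvg f x l &
    forall y, (forall n, S n y) -> f l l <= f y y].
Proof.
move=> S_decr S_mid S_bnd.
pose D n := [set f x x | x in S n]; pose d n := inf (D n).
have D_lb n : has_lbound (D n) by exists 0 => _ [x _ <-]; exact: si_ge0.
have D_inf n : has_inf (D n).
  by split=> //; have [x Sx _] := S_bnd n; exists (f x x); exists x.
have d_le n x : S n x -> d n <= f x x.
  by move=> Sx; apply: ge_inf => //; exists x.
have d_nondecr : nondecreasing_seq d.
  move=> n m nm; apply: lb_le_inf; first exact: (D_inf m).1.
  by move=> _ [x Sx <-]; apply: d_le; exact: S_decr Sx.
have d_ub n : d n <= C.
  by have [x Sx fx] := S_bnd n; exact: le_trans (d_le _ _ Sx) fx.
have d_cvg : cvgn d.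
  by apply: nondecreasing_is_cvgn => //; exists C => _ [n _ <-].
have d_lim n : d n <= limn d by exact: nondecreasing_cvgn_le.
have /choice[x xP] : forall n, exists x, S n x /\ f x x < d n + n.+1%:R^-1.
  move=> n; have n1_gt0 : 0 < n.+1%:R^-1 :> R by rewrite invr_gt0.
  have [_ [x Sx <-] fx] := inf_adherent n1_gt0 (D_inf n).
  by exists x.
have xS n : S n (x n) by exact: (xP n).1.
have fx n : f (x n) (x n) < d n + n.+1%:R^-1 by exact: (xP n).2.
have inv0 : (fun n => n.+1%:R^-1 : R) @ \oo --> (0 : R) by exact: cvg_harmonic.
have [l xl] : exists l, si_cvg f x l.
  (* The midpoint of [x n] and [x m] lies in [S n], so the squared distance is at most
     [2 f(x_n,x_n) + 2 f(x_m,x_m) - 4 d_n]; now bound [d m] by the limit. *)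
  apply: (f_complete (e := fun n => 2 * (limn d - d n) + 4 * n.+1%:R^-1)).
    rewrite [X in _ --> X](_ : 0 = 2 * (limn d - limn d) + 4 * 0); last by ring.
    apply: cvgD; apply: cvgM; try exact: cvg_cst; last exact: inv0.
    by apply: cvgB; [exact: cvg_cst|exact: d_cvg].
  move=> n m nm.
  have := d_le n _ (S_mid n _ _ (xS n) (S_decr _ _ nm _ (xS m))).
  rewrite !(siE fP) (siC fP (x m) (x n)).
  have := fx n; have := fx m; have := d_lim m.
  have : m.+1%:R^-1 <= n.+1%:R^-1 :> R by rewrite lef_pV2 ?posrE// ler_nat ltnS.
  move: (n.+1%:R^-1) (m.+1%:R^-1) => a b.
  lra.
exists x, l; split=> // y Sy.
apply: (@ler_cvg_to _ _ _ _ (fun n => f (x n) (x n))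
  (fun n => f y y + n.+1%:R^-1) _ _ (si_cvg_sqr fP xl)).
  by rewrite -[X in _ --> X]addr0; apply: cvgD => //; exact: cvg_cst.
near=> n; have := fx n; have := d_le n _ (Sy n).
by move: (n.+1%:R^-1) => a; lra.
Unshelve. all: by end_near. Qed.

(** The constant sequence of sets [S - x] yields an element [l] of least norm, and [x + l] is the
    projection. *)
Lemma orthogonal_decomposition (S : set E) (x : E) :
  S 0 -> (forall a y z, S y -> S z -> S (a *: y + z)) ->
  (forall y l, (forall n, S (y n)) -> si_cvg f y l -> S l) ->
  exists2 p, S p & forall s, S s -> f (x - p) s = 0.
Proof.
move=> S0 S_lin S_closed.
have SZ a y : S y -> S (a *: y).
  by move=> Sy; rewrite -[_ *: _]addr0; exact: S_lin.
have SD y z : S y -> S z -> S (y + z).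
  by move=> Sy Sz; rewrite -[y]scale1r; exact: S_lin.
have [||n|y [l [Sy yl l_min]]] :=
    @nested_convex_limit (fun _ => [set y | S (x + y)]) (f x x).
- by move=> n m _ y.
- move=> _ y z /= Sy Sz; rewrite (_ : x + _ = 2^-1 *: ((x + y) + (x + z))).
    exact/SZ/SD.
  by rewrite addrACA [RHS]scalerDr scale_half_double.
- by exists (- x); rewrite /= ?subrr ?(siNl fP) ?(siNr fP) ?opprK.
have Sl : S (x + l).
  apply: (S_closed (fun n => x + y n)) => //.
  by rewrite /si_cvg; under eq_fun do rewrite opprD addrACA subrr add0r.
exists (x + l) => // s Ss; rewrite opprD addNKr (siNl fP).
(* Minimality of [l] against [l + t *: s] gives a nonnegative quadratic in [t] without constant
   term, so the discriminant bound applies with [a = 0]. *)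
have : f l s ^+ 2 <= 0 * f s s.
  apply: discriminant_le => [|t]; first exact: si_ge0.
  have := l_min (l + t *: s); rewrite !(siE fP) (siC fP s l).
  suff Sls : S (x + (l + t *: s)) by move=> /(_ (fun=> Sls)); lra.
  by rewrite addrA; apply: SD => //; exact: SZ.
rewrite mul0r => fls_le0; apply/eqP.
by rewrite oppr_eq0 -sqrf_eq0 eq_le fls_le0 sqr_ge0.
Qed.

End Completeness.

(** * Chebyshev polynomials of a symmetric operator *)

Section Chebyshev.
Context {R : realType} {E : lmodType R}.
Variable g : E -> E -> R.
Hypothesis gP : semi_inner g.
Variables (T : E -> E) (D : set E).
Hypothesis T_lin : real_linear T.
Hypothesis T_sym : forall x y, g (T x) y = g x (T y).
Hypothesis D_lin : forall a x y, D x -> D y -> D (a *: x + y).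
Hypothesis D_stable : forall x, D x -> D (T x).
Variables s t : R.
Hypothesis s_gt0 : 0 < s.
Hypothesis st : s <= t.
Hypothesis T_ge : forall x, D x -> s ^+ 2 * g x x <= g (T x) x.
Hypothesis T_le : forall x, D x -> g (T x) x <= t ^+ 2 * g x x.

Let s2_le_t2 : s ^+ 2 <= t ^+ 2.
Proof. by rewrite ler_pXn2r// nnegrE ltW// (lt_le_trans s_gt0). Qed.

(* The positive operators [T - s^2] and [t^2 - T] commute; Cauchy-Schwarz for
   the form of [T - s^2] gives [(T - s^2)^2 <= (t^2 - s^2) (T - s^2)]. *)
Lemma spectral_interval_ge0 x : D x ->
  0 <= g (T x - s ^+ 2 *: x) (t ^+ 2 *: x - T x).
Proof.
move=> Dx; set a := s ^+ 2; set b := t ^+ 2.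
have DZN y z c : D y -> D z -> D (y + c *: z).
  by move=> Dy Dz; rewrite addrC; exact: D_lin.
pose S y := T y - a *: y.
have DS y : D y -> D (S y).
  by move=> Dy; rewrite /S -scaleNr; apply: DZN => //; exact: D_stable.
have S_sym y z : g (S y) z = g y (S z) by rewrite /S !(siE gP) T_sym.
have S_ge0 y : D y -> 0 <= g (S y) y.
  by move=> /T_ge; rewrite /S !(siE gP) subr_ge0.
have S_le y : D y -> g (S y) y <= (b - a) * g y y.
  by move=> /T_le; rewrite /S !(siE gP) mulrBl lerD2r.
have cs : g (S x) (S x) ^+ 2 <= g (S x) x * g (S (S x)) (S x).
  apply: discriminant_le => [|c]; first exact/S_ge0/DS.
  have := S_ge0 _ (DZN _ _ c Dx (DS _ Dx)).
  suff -> : g (S (x + c *: S x)) (x + c *: S x) =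
      g (S x) x + 2 * c * g (S x) (S x) + c ^+ 2 * g (S (S x)) (S x) by [].
  have SS : g (S (S x)) x = g (S x) (S x) by rewrite S_sym.
  have -> : S (x + c *: S x) = S x + c *: S (S x).
    rewrite /S (rlinD T_lin) (rlinZ T_lin) scalerDr [in RHS]scalerDr !scalerN.
    by rewrite opprD addrACA !scalerA (mulrC a).
  by move: (S x) (S (S x)) SS => y z yz; rewrite !(siE gP) yz; ring.
rewrite -/(S x).
have -> : b *: x - T x = (b - a) *: x - S x.
  by rewrite /S scalerBl opprB subrKA.
have := S_le _ (DS _ Dx); have := S_ge0 _ Dx; have := si_ge0 gP (S x); move: cs.
move: (S (S x)) (S x) => z y; rewrite !(siE gP).
move: (g y y) (g y x) (g z y) => G p q G2 G_ge0 p_ge0 q_le.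
(* What remains is [G <= (b - a) p]; it follows from [G^2 <= p q] and [q <= (b - a) G] after
   division by [G]. *)
have [G0|G_neq0] := eqVneq G 0; first by rewrite G0 subr0 mulr_ge0// subr_ge0.
have G_gt0 : 0 < G by rewrite lt_neqAle eq_sym G_neq0.
rewrite subr_ge0 -(ler_pM2r G_gt0) -expr2 (le_trans G2)//.
by rewrite [leRHS](_ : _ = p * ((b - a) * G)) ?ler_wpM2l//; ring.
Qed.

(** For [s < t], [X / w] carries the spectral interval [[s^2, t^2]] onto [[-1, 1]]. Polynomials are
    kept homogeneous in [X] and [w], since [w] vanishes for [s = t]. *)
Let X x := (s ^+ 2 + t ^+ 2) *: x - 2 *: T x.

Let X_sym x y : g (X x) y = g x (X y).
Proof. by rewrite /X !(siE gP) T_sym. Qed.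

Let X_lin : real_linear X.
Proof.
move=> a x y; rewrite /X T_lin !scalerDr !opprD scalerN !scalerA.
by rewrite !(mulrC a) addrACA.
Qed.

Let DX x : D x -> D (X x).
Proof.
move=> Dx; rewrite /X addrC -scaleNr; apply: D_lin; first exact: D_stable.
rewrite -[_ *: x]addr0; apply: D_lin => //.
by rewrite -(subrr x) addrC -scaleN1r; exact: D_lin.
Qed.

Let w := t ^+ 2 - s ^+ 2.

(** Factor [w^2 - X^2 = 4 (T - s^2) (t^2 - T)]. *)
Let X_le x : D x -> g (X x) (X x) <= w ^+ 2 * g x x.
Proof.
move=> /spectral_interval_ge0; rewrite /X /w !(siE gP) (siC gP x (T x)).
by move: (g (T x) (T x)) (g (T x) x) (g x x) => A C G; lra.
Qed.

(** [P n] stands for the span of [T x0, ..., T^n x0], so that [q(T) x0] lies in [q(0) x0 + P n] when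
    [q] has degree at most [n]. The bound [N] allows for an iteration that stops. *)
Variables (x0 : E) (N : nat) (P : nat -> set E).
Hypothesis Dx0 : D x0.
Hypothesis P_lin : forall n a x y, P n x -> P n y -> P n (a *: x + y).
Hypothesis P0 : forall n, P n 0.
Hypothesis P_mono : forall n, P n `<=` P n.+1.
Hypothesis TP : forall n x, (n < N)%N -> P n x -> P n.+1 (T x).
Hypothesis Tx0 : (0 < N)%N -> P 1%N (T x0).

(** [A] and [A'] are the roots of [z^2 - 2 (s^2 + t^2) z + w^2], the characteristic polynomial of
    the Chebyshev recurrence at [T = 0], and [A - A' = 4 t s]. Hence [gm n] and [dl n] are the
    values at [0] of the polynomials of the first and second kind. *)
Let A := (t + s) ^+ 2.
Let A' := (t - s) ^+ 2.
Let dl n := (A ^+ n - A' ^+ n) / (4 * t * s).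
Let gm n := (A ^+ n + A' ^+ n) / 2.

Let t_gt0 : 0 < t. Proof. exact: lt_le_trans st. Qed.

(* [c] and [d] are the values at [x0] of [w^n T_n(X/w)] and
   [w^(n-1) U_(n-1)(X/w)], with Chebyshev polynomials of the first and second
   kind in [X = s^2 + t^2 - 2 T], and [w = t^2 - s^2]. The last clause is
   Pell's equation [T_n^2 + (1 - X^2) U_(n-1)^2 = 1]. *)
Let chebyshev_pair n : (n <= N)%N -> exists c d,
  [/\ D c, D d, P n (c - gm n *: x0),
      P n (d - dl n *: x0) /\ P n (c + X d - dl n.+1 *: x0) &
      g c c + w ^+ 2 * g d d - g (X d) (X d) = w ^+ (2 * n) * g x0 x0].
Proof.
have D0 : D 0 by rewrite -(subrr x0) addrC -scaleN1r; exact: D_lin.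
have PZ m a y : P m y -> P m (a *: y).
  by move=> Py; rewrite -[_ *: _]addr0; exact: P_lin.
have PD m y z : P m y -> P m z -> P m (y + z).
  by move=> Py Pz; rewrite -[y]scale1r; exact: P_lin.
have t_neq0 : t != 0 by rewrite gt_eqF.
have s_neq0 : s != 0 by rewrite gt_eqF.
elim: n => [_|n IH nN].
  exists x0, 0; have X0 : X 0 = 0 by rewrite (rlin0 X_lin).
  split=> //; last by rewrite X0 !(si0l gP) mulr0 subr0 addr0 muln0 mul1r.
    rewrite (_ : gm 0 = 1) ?scale1r ?subrr//.
    by rewrite /gm !expr0; field.
  rewrite (_ : dl 0 = 0) ?scale0r ?subrr//; last first.
    by rewrite /dl !expr0 subrr mul0r.
  split=> //; rewrite (_ : dl 1 = 1) ?scale1r ?X0 ?addr0 ?subrr//.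
  by rewrite /dl /A /A'; field; rewrite t_neq0 s_neq0.
have [c [d [Dc Dd Pc [Pd Pd'] pell]]] := IH (ltnW nN).
(* The recurrences are [U_n = x U_(n-1) + T_n] and [T_(n+1) = x U_n - U_(n-1)], scaled by powers of
   [w]. As [d'] has degree only [n], its membership is already available in [P n], and applying [X]
   leads to [P n.+1]. *)
have [d' d'E] : exists d', d' = c + X d by exists (c + X d).
rewrite -d'E in Pd'.
have Dd' : D d' by rewrite d'E -[c]scale1r; apply: D_lin => //; exact: DX.
have PT : P n.+1 (T x0).
  have N0 : (0 < N)%N by exact: leq_ltn_trans nN.
  by elim: n {IH nN Pc Pd Pd' pell} => [|n IHn]; [exact: Tx0|exact: P_mono].
have PX : P n.+1 (X d' - ((s ^+ 2 + t ^+ 2) * dl n.+1) *: x0).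
  have -> : X d' - ((s ^+ 2 + t ^+ 2) * dl n.+1) *: x0 =
      (s ^+ 2 + t ^+ 2) *: (d' - dl n.+1 *: x0) +
      ((- 2) *: T (d' - dl n.+1 *: x0) + (- (2 * dl n.+1)) *: T x0).
    rewrite (rlinD T_lin) (rlinN T_lin) (rlinZ T_lin) !scalerBr !scalerA mulNr.
    by rewrite subrK /X scaleNr addrAC.
  by apply/PD; [exact/PZ/P_mono|apply/PD; [exact/PZ/TP|exact: PZ]].
have Pd1 := P_mono Pd; have Pd'1 := P_mono Pd'.
have Pc1 : P n.+1 (X d' - w ^+ 2 *: d - gm n.+1 *: x0).
  have -> : X d' - w ^+ 2 *: d - gm n.+1 *: x0 =
      (X d' - ((s ^+ 2 + t ^+ 2) * dl n.+1) *: x0) +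
      (- w ^+ 2) *: (d - dl n *: x0).
    rewrite scalerBr !scaleNr opprK scalerA [RHS]addrACA; congr (_ + _).
    rewrite addrC -scalerBl -[LHS]scaleNr; congr (_ *: _).
    rewrite /gm /dl (exprS A n) (exprS A' n); move: (A ^+ n) (A' ^+ n) => y z.
    by rewrite /A /A' /w; field; rewrite t_neq0 s_neq0.
  by apply/PD => //; exact: PZ.
exists (X d' - w ^+ 2 *: d), d'; split=> //.
- by rewrite addrC -scaleNr; apply: D_lin => //; exact: DX.
- split=> //; have -> : X d' - w ^+ 2 *: d + X d' - dl n.+2 *: x0 =
      (X d' - w ^+ 2 *: d - gm n.+1 *: x0) +
      (X d' - ((s ^+ 2 + t ^+ 2) * dl n.+1) *: x0).
    rewrite [RHS]addrACA; congr (_ + _).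
    rewrite -opprD -scalerDl; congr (- (_ *: _)).
    rewrite /gm /dl (exprS A n.+1) (exprS A' n.+1) (exprS A n) (exprS A' n).
    move: (A ^+ n) (A' ^+ n) => y z.
    by rewrite /A /A'; field; rewrite t_neq0 s_neq0.
  exact: PD.
(* Pell's equation is propagated by the symmetry [g (X d') d = g d' (X d)] alone. *)
rewrite (_ : 2 * n.+1 = 2 + 2 * n)%N ?mulnS// exprD -mulrA -pell.
rewrite [in RHS](_ : c = d' - X d); last by rewrite d'E addrK.
move: (X_sym d' d); move: (X d') (X d) => y z.
rewrite !(siE gP) (siC gP d y) (siC gP z d') => ->.
by ring.
Qed.

(* The coefficient of [x0] is the value at [0] of the polynomial
   [w^n T_n((s^2 + t^2 - 2 T) / w)]. *)
Lemma chebyshev_vector n : (n <= N)%N -> exists c,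
  P n (c - (((t + s) ^+ 2) ^+ n + ((t - s) ^+ 2) ^+ n) / 2 *: x0) /\
  g c c <= (t ^+ 2 - s ^+ 2) ^+ (2 * n) * g x0 x0.
Proof.
move=> /chebyshev_pair[c [d [_ Dd Pc _ pell]]]; exists c; split=> //.
by rewrite -/w -pell; have := X_le Dd; lra.
Qed.

End Chebyshev.

(** * Conjugate gradients for the normal equation *)

Section ConjugateGradients.
Context {R : realType} {E : lmodType R}.
Variable f : E -> E -> R.
Hypothesis fP : semi_inner f.
Hypothesis f_definite : forall x, f x x = 0 -> x = 0.

Variables B Bs : E -> E.
Hypothesis B_lin : real_linear B.
Hypothesis Bs_lin : real_linear Bs.
Hypothesis B_adj : forall x y, f (Bs y) x = f y (B x).
Hypothesis B_le : forall x, f (B x) (B x) <= f x x.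

Variables (b : E) (u r p : nat -> E).
Hypothesis r_def : forall n, r n = Bs (B (u n) - b).
Hypothesis p0 : r 0%N != 0 -> p 0%N = - r 0%N.
Hypothesis pS : forall n, r n.+1 != 0 ->
  p n.+1 = - r n.+1 + (f (r n.+1) (r n.+1) / f (r n) (r n)) *: p n.
Hypothesis uS : forall n, r n != 0 ->
  u n.+1 = u n + (f (r n) (r n) / f (B (p n)) (B (p n))) *: p n.
Hypothesis u_stop : forall n, r n = 0 -> u n.+1 = u n.

Let BD := rlinD B_lin.
Let BZ := rlinZ B_lin.
Let BN := rlinN B_lin.

Let alpha n := f (r n) (r n) / f (B (p n)) (B (p n)).
Let beta n := if n is m.+1 then f (r n) (r n) / f (r m) (r m) else 0.

(** At [n = 0] the coefficient [beta 0] is [0], so the predecessor [0.-1 = 0] does no harm. *)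
Let p_rec n : r n != 0 -> p n = - r n + beta n *: p n.-1.
Proof. by case: n => [/p0 ->|n /pS //]; rewrite scale0r addr0. Qed.

Let beta_ge0 n : 0 <= beta n.
Proof. by case: n => // n; rewrite divr_ge0// (si_ge0 fP). Qed.

Let alpha_ge0 n : 0 <= alpha n.
Proof. by rewrite divr_ge0// (si_ge0 fP). Qed.

Let r_gt0 n : r n != 0 -> 0 < f (r n) (r n).
Proof.
move=> rn; rewrite lt_neqAle (si_ge0 fP) andbT eq_sym.
by apply: contra_neq rn => /f_definite.
Qed.

Let r_form n x : f (r n) x = f (B (u n) - b) (B x).
Proof. by rewrite r_def B_adj. Qed.

Lemma cg_stopped m n : (m <= n)%N -> r m = 0 -> r n = 0 /\ u n = u m.
Proof.
move=> + rm; elim: n => [|n IHn]; first by rewrite leqn0 => /eqP <-.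
rewrite leq_eqVlt ltnS => /orP[/eqP <- //|/IHn[rn un]].
by rewrite r_def u_stop// un -r_def.
Qed.

Lemma cg_running m n : (m <= n)%N -> r n != 0 -> r m != 0.
Proof. by move=> mn; apply: contra_neq => /(cg_stopped mn)[]. Qed.

Lemma cg_residualS n : r n != 0 -> r n.+1 = r n + alpha n *: Bs (B (p n)).
Proof.
by move=> rn; rewrite (r_def n.+1) uS// BD BZ addrAC addrC Bs_lin -r_def addrC.
Qed.

Let orth n := forall i, (i < n)%N -> f (r n) (p i) = 0.

Let orth_rp n : orth n -> r n != 0 -> f (r n) (p n) = - f (r n) (r n).
Proof.
move=> on rn; rewrite p_rec// !(siE fP); case: n on rn => [|n] on rn /=.
  by rewrite mul0r addr0.
by rewrite on// mulr0 addr0.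
Qed.

(** If [B (p n)] had length zero, so would the product of [r n] and [p n], which is [-|r_n|^2 < 0].
    Thus the step length has a nonzero denominator. *)
Let orth_Bp_gt0 n : orth n -> r n != 0 -> 0 < f (B (p n)) (B (p n)).
Proof.
move=> on rn; rewrite lt_neqAle (si_ge0 fP) andbT eq_sym.
apply/eqP => Bp0; have := orth_rp on rn.
rewrite r_form (siC fP) (si_eq0l fP _ Bp0) => /esym/eqP.
by rewrite oppr_eq0 gt_eqF// r_gt0.
Qed.

(** A simultaneous induction: orthogonality at [n + 1] uses conjugacy at [n], and conjugacy at
    [n + 1] uses that [r n.+1] is orthogonal to all earlier residuals. Conjugacy is asserted only
    while the iteration runs, as later directions are arbitrary. *)
Let orth_conj n :
  orth n /\ (r n != 0 -> forall i, (i < n)%N -> f (B (p n)) (B (p i)) = 0).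
Proof.
elim/ltn_ind: n => -[_|n IH]; first by split.
have [rn0|rn] := eqVneq (r n) 0.
  have [rn10 _] := cg_stopped (leqnSn n) rn0.
  by split=> [i _|]; rewrite rn10 ?(si0l fP) ?eqxx.
have [on cn] := IH n (ltnSn n).
have Bp_gt0 := orth_Bp_gt0 on rn.
have oS : orth n.+1.
  move=> i; rewrite ltnS leq_eqVlt cg_residualS// !(siE fP) B_adj.
  move=> /orP[/eqP ->|lt_in]; last by rewrite on// cn// mulr0 addr0.
  by rewrite orth_rp// /alpha divfK ?gt_eqF// addNr.
have rrS i : (i <= n)%N -> f (r n.+1) (r i) = 0.
  move=> le_in; have ri := cg_running le_in rn.
  have -> : r i = - p i + beta i *: p i.-1 by rewrite p_rec// opprD opprK subrK.
  rewrite !(siE fP) (oS i)// oppr0 add0r oS ?mulr0//.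
  by rewrite ltnS (leq_trans (leq_pred i)).
split=> // rn1 i; rewrite ltnS => le_in.
have ri := cg_running le_in rn; have [oi _] := IH i le_in.
have Bpi_gt0 := orth_Bp_gt0 oi ri.
have alpha_i : alpha i != 0 by rewrite gt_eqF// divr_gt0// r_gt0.
apply: (mulfI alpha_i); rewrite mulr0 p_rec// BD BZ BN !(siE fP).
(* [B (p i)] is reached through [alpha i *: Bs (B (p i)) = r i.+1 - r i]. For [i < n] both residuals
   are orthogonal to [r n.+1]; for [i = n] the choice of [beta] cancels what is left. *)
have : f (r n.+1) (r i.+1) =
    f (r n.+1) (r i) + alpha i * f (B (r n.+1)) (B (p i)).
  rewrite (cg_residualS ri) !(siE fP) (siC fP _ (Bs _)) B_adj.
  by rewrite (siC fP (B (p i))).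
rewrite (rrS i)// add0r; move: le_in; rewrite leq_eqVlt => /orP[/eqP i_n|lt_in].
  rewrite -i_n mulrDr => r1; rewrite mulrN -r1 /= /alpha.
  by field; rewrite !gt_eqF// r_gt0.
by rewrite (rrS i.+1)// mulrDr mulrN => <-; rewrite oppr0 add0r /= cn// !mulr0.
Qed.

Lemma cg_orth n i : (i < n)%N -> f (r n) (p i) = 0.
Proof. by case: (orth_conj n) => h _; exact: h. Qed.

Lemma cg_conjugate n i : r n != 0 -> (i < n)%N -> f (B (p n)) (B (p i)) = 0.
Proof. by move=> rn; case: (orth_conj n) => _; exact. Qed.

Lemma cg_residual_direction n : r n != 0 -> f (r n) (p n) = - f (r n) (r n).
Proof. by apply: orth_rp; case: (orth_conj n). Qed.

Lemma cg_image_gt0 n : r n != 0 -> 0 < f (B (p n)) (B (p n)).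
Proof. by apply: orth_Bp_gt0; case: (orth_conj n). Qed.

(* The step length is at least [1], because [B p_n] is the part of [- B r_n]
   orthogonal to [B p_(n-1)]. *)
Lemma cg_functional_decrease n :
  f (B (u n.+1) - b) (B (u n.+1) - b) <=
  f (B (u n) - b) (B (u n) - b) - f (r n) (r n).
Proof.
have [rn0|rn] := eqVneq (r n) 0.
  by rewrite u_stop// rn0 (si0l fP) subr0.
have Bp_gt0 := cg_image_gt0 rn.
have Bp_le : f (B (p n)) (B (p n)) <= f (r n) (r n).
  apply: le_trans (B_le (r n)).
  have pw : f (B (p n)) (B (beta n *: p n.-1)) = 0.
    rewrite BZ (siZr fP); case: n rn {Bp_gt0} => [|n] rn /=.
      by rewrite mul0r.
    by rewrite cg_conjugate// mulr0.
  have -> : r n = - p n + beta n *: p n.-1 by rewrite p_rec// opprD opprK subrK.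
  rewrite BD BN; move: (B (beta n *: _)) pw => w pw.
  rewrite !(siE fP) (siC fP w) pw; have := si_ge0 fP w; lra.
have alpha_ge1 : 1 <= alpha n by rewrite ler_pdivlMr// mul1r.
(* Since [alpha |B p|^2 = |r|^2], the functional drops by exactly [alpha |r|^2]. *)
have := cg_residual_direction rn; rewrite r_form uS// BD BZ -/(alpha n).
rewrite addrAC; move: (B (u n) - b) => y h.
have alphaBp : alpha n * f (B (p n)) (B (p n)) = f (r n) (r n).
  by rewrite divfK// gt_eqF.
rewrite !(siE fP) alphaBp (siC fP (B _)) h; have := r_gt0 rn; nra.
Qed.

Lemma cg_residual_cvg : (fun n => f (r n) (r n)) @ \oo --> (0 : R).
Proof.
pose J n := f (B (u n) - b) (B (u n) - b).
have J_cvg : cvgn J.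
  apply: nonincreasing_is_cvgn.
    apply/nonincreasing_seqP => n; apply: le_trans (cg_functional_decrease n) _.
    by rewrite lerBlDr lerDl (si_ge0 fP).
  by exists 0 => _ [n _ <-]; exact: si_ge0.
apply: (@squeeze_cvgr _ _ _ _ (cst 0) (fun n => J n - J n.+1)).
- near=> n; rewrite (si_ge0 fP)/=; have := cg_functional_decrease n.
  by rewrite -/(J n) -/(J n.+1); lra.
- exact: cvg_cst.
- rewrite -(subrr (limn J)); apply: cvgB => //.
  by rewrite -(cvg_shiftS J) in J_cvg *.
Unshelve. all: by end_near. Qed.

Lemma cg_orth_increment n m : (m <= n)%N -> f (r n) (u m - u 0%N) = 0.
Proof.
elim: m => [|m IHm] mn; first by rewrite subrr (si0r fP).
have [rm|rm] := eqVneq (r m) 0; first by rewrite u_stop// IHm// ltnW.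
rewrite uS// addrAC (siDr fP) IHm ?(ltnW mn)// (siZr fP) cg_orth//.
by rewrite mulr0 addr0.
Qed.

(** Residuals lie in the range of [Bs], which is orthogonal to the kernel of [B]; directions and
    increments are combinations of residuals. *)
Lemma cg_increment_kernel n y : B y = 0 -> f (u n - u 0%N) y = 0.
Proof.
move=> By; have rk k : f (r k) y = 0 by rewrite r_form By (si0r fP).
have pk k : r k != 0 -> f (p k) y = 0.
  elim: k => [|k IHk] rk0; rewrite p_rec// !(siE fP) rk ?mul0r ?oppr0 ?add0r//.
  by rewrite IHk ?mulr0//; exact: cg_running rk0.
elim: n => [|n IHn]; first by rewrite subrr (si0l fP).
have [rn|rn] := eqVneq (r n) 0; first by rewrite u_stop.
by rewrite uS// addrAC (siDl fP) IHn (siZl fP) pk// mulr0 addr0.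
Qed.

(** * Errors relative to a solution, and the rate of convergence *)

Section Solution.
Variable us : E.
Hypothesis us_sol : Bs (B us - b) = 0.

Let r_error n : r n = Bs (B (u n - us)).
Proof.
have := Bs_lin (-1) (B us - b) (B (u n) - b).
rewrite us_sol scaler0 add0r r_def.
by move=> <-; rewrite BD BN scaleN1r opprB addrC addrA subrK.
Qed.

(** Symmetry of [Bs B] exchanges the indices of residual and error, and the two errors differ by
    increments orthogonal to [r n]. *)
Let r_error_swap n m : (m <= n)%N ->
  f (r m) (u n - us) = f (B (u n - us)) (B (u n - us)).
Proof.
move=> mn; rewrite r_error B_adj (siC fP) -B_adj -r_error.
have -> : u m - us = (u m - u 0%N) - (u n - u 0%N) + (u n - us).
  by rewrite opprB !subrKA.
rewrite (siDr fP) (siDr fP) (siNr fP) !cg_orth_increment// subrr add0r.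
by rewrite r_error B_adj.
Qed.

(** Unfolded, [- p m] is a combination of [r 0, ..., r m] with nonnegative coefficients, and each of
    these residuals has product [|B e_n|^2] with the error [e_n]. *)
Lemma cg_direction_error m n : r m != 0 -> (m <= n)%N ->
  f (p m) (u n - us) <= 0.
Proof.
elim: m => [|m IHm] rm mn;
  rewrite p_rec// (siDl fP) (siNl fP) (siZl fP) r_error_swap//.
  by rewrite mul0r addr0 oppr_le0 (si_ge0 fP).
have := si_ge0 fP (B (u n - us)).
have := IHm (cg_running (leqnSn m) rm) (ltnW mn).
have := beta_ge0 m.+1; rewrite /=; move: (_ / _) => c; nra.
Qed.

(* Every direction [p_m] makes an acute angle with the errors [us - u_n],
   [m <= n]. *)
Lemma cg_error_decrease m n : (m <= n)%N ->
  f (u n - u m) (u n - u m) <=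
  f (u m - us) (u m - us) - f (u n - us) (u n - us).
Proof.
move=> mn; have acute k : (m <= k <= n)%N -> f (u k - u m) (u n - us) <= 0.
  elim: k => [|k IHk] /andP[mk kn].
    by move: mk; rewrite leqn0 => /eqP ->; rewrite subrr (si0l fP).
  move: mk; rewrite leq_eqVlt => /orP[/eqP ->|mk].
    by rewrite subrr (si0l fP).
  have := IHk; rewrite -ltnS mk (ltnW kn) => /(_ isT) {}IHk.
  have [rk|rk] := eqVneq (r k) 0; first by rewrite u_stop.
  rewrite uS// addrAC !(siDl fP (_ - _)) (siZl fP) -/(alpha k).
  rewrite -oppr_ge0 opprD addr_ge0 ?oppr_ge0// mulr_ge0_le0//.
  by rewrite cg_direction_error// ltnW.
have := acute n; rewrite mn leqnn => /(_ isT).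
have -> : u m - us = (u n - us) - (u n - u m).
  by rewrite opprB [RHS]addrC subrKA.
by move: (u n - us) (u n - u m) => v w; rewrite !(siE fP) (siC fP v w); lra.
Qed.

(* The span of the first [n] directions, as a double orthogonal complement. *)
Let krylov n : set E :=
  [set x | forall y, (forall i, (i < n)%N -> f (p i) y = 0) -> f x y = 0].

Let krylov_residual n j y : r j != 0 -> (j < n)%N ->
  (forall i, (i < n)%N -> f (p i) y = 0) -> f (r j) y = 0.
Proof.
move=> rj jn py; have -> : r j = - p j + beta j *: p j.-1.
  by rewrite p_rec// opprD opprK subrK.
rewrite (siDl fP) (siNl fP) (siZl fP) !py ?mulr0 ?oppr0 ?addr0//.
exact: leq_ltn_trans (leq_pred j) jn.
Qed.

(** By symmetry of [Bs B] it suffices that [y] is orthogonal to [Bs (B (p i))], a multiple of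
    [r i.+1 - r i]. The residual [r i.+1] must be nonzero to be a combination of directions, whence
    the strict bound by [N]. *)
Let krylov_stable N n x : (forall j, (j < N)%N -> r j != 0) -> (n < N)%N ->
  krylov n x -> krylov n.+1 (Bs (B x)).
Proof.
move=> rN nN Px y py; rewrite B_adj (siC fP) -B_adj (siC fP).
apply: Px => i lt_in; have ri : r i != 0 by apply: rN; exact: ltn_trans nN.
have alpha_i : alpha i != 0.
  by rewrite gt_eqF// divr_gt0 ?r_gt0// cg_image_gt0.
apply: (mulfI alpha_i); rewrite mulr0 (siC fP) B_adj (siC fP) -B_adj.
have := krylov_residual (rN i.+1 (leq_ltn_trans lt_in nN))
  (lt_in : (i.+1 < n.+1)%N) py.
rewrite cg_residualS// (siDl fP) (siZl fP) => <-.
by rewrite (krylov_residual ri _ py) ?add0r// ltnS ltnW.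
Qed.

Variables s t : R.
Hypothesis s_gt0 : 0 < s.
Hypothesis st : s <= t.
Let D : set E := [set x | forall y, B y = 0 -> f x y = 0].
Hypothesis B_ge : forall x, D x -> s ^+ 2 * f x x <= f (B x) (B x).
Hypothesis BsB_le : forall x,
  f (Bs (B x)) (Bs (B x)) <= t ^+ 2 * f (B x) (B x).
Hypothesis D_error : D (u 0%N - us).

Let energy x y := f (B x) (B y).

Let energyP : semi_inner energy.
Proof.
split=> [x y|x y z|a x y|x]; rewrite /energy ?BD ?BZ.
- exact: siC.
- exact: siDl.
- exact: siZl.
- exact: si_ge0.
Qed.

Let cs_energy x : f (B x) (B x) ^+ 2 <= f (Bs (B x)) (Bs (B x)) * f x x.
Proof. by rewrite -[f (B x) (B x)]B_adj cauchy_schwarz. Qed.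

Let D_lin a x y : D x -> D y -> D (a *: x + y).
Proof.
by move=> Dx Dy z Bz; rewrite (siDl fP) (siZl fP) Dx// Dy// mulr0 addr0.
Qed.

(** With [a = |x|^2], [c = |B x|^2] and [d = |Bs B x|^2], Cauchy-Schwarz gives [c^2 <= d a];
    together with [s^2 a <= c] this yields [s^2 c^2 <= c d]. *)
Let energy_ge x : D x -> s ^+ 2 * energy x x <= energy (Bs (B x)) x.
Proof.
have -> : energy (Bs (B x)) x = f (Bs (B x)) (Bs (B x)).
  by rewrite /energy (siC fP) -B_adj.
move=> /B_ge; rewrite /energy; have := cs_energy x.
have := si_ge0 fP (Bs (B x)); have := si_ge0 fP (B x); have := si_ge0 fP x.
move: (f x x) (f (B x) (B x)) (f (Bs (B x)) (Bs (B x))) => a c d a0 c0 d0 cs sa.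
have [->|c_neq0] := eqVneq c 0; first by rewrite mulr0.
have c_gt0 : 0 < c by rewrite lt_neqAle eq_sym c_neq0.
rewrite -(ler_pM2r c_gt0) -mulrA -expr2.
apply: le_trans (ler_wpM2l (sqr_ge0 s) cs) _.
by rewrite mulrCA ler_wpM2l.
Qed.

Lemma cg_image_le x : f (B x) (B x) <= t ^+ 2 * f x x.
Proof.
have := cs_energy x; have := BsB_le x.
have := si_ge0 fP (Bs (B x)); have := si_ge0 fP (B x); have := si_ge0 fP x.
move: (f x x) (f (B x) (B x)) (f (Bs (B x)) (Bs (B x))) => a c d a0 c0 d0 dc cs.
have [->|c_neq0] := eqVneq c 0; first by rewrite mulr_ge0 ?sqr_ge0.
have c_gt0 : 0 < c by rewrite lt_neqAle eq_sym c_neq0.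
rewrite -(ler_pM2r c_gt0) -expr2 (le_trans cs)// mulrAC.
exact: ler_wpM2r.
Qed.

(* [u_n] minimises the energy of the error over [u_0 + krylov n]. *)
Lemma cg_rate n : (forall j, (j < n)%N -> r j != 0) ->
  s ^+ 2 * ((t + s) ^+ 2) ^+ (2 * n) * f (u n - us) (u n - us) <=
  4 * t ^+ 2 * (t ^+ 2 - s ^+ 2) ^+ (2 * n) * f (u 0%N - us) (u 0%N - us).
Proof.
move=> rn; have T_lin : real_linear (Bs \o B).
  by move=> a x y /=; rewrite B_lin Bs_lin.
have T_sym x y : energy ((Bs \o B) x) y = energy x ((Bs \o B) y).
  by rewrite /energy /= (siC fP) -!B_adj (siC fP).
have T_D x : D x -> D ((Bs \o B) x).
  by move=> _ y By; rewrite /= B_adj By (si0r fP).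
have T_le x : D x -> energy ((Bs \o B) x) x <= t ^+ 2 * energy x x.
  by move=> _; rewrite /energy /= (siC fP) -B_adj BsB_le.
have K_lin m a x y : krylov m x -> krylov m y -> krylov m (a *: x + y).
  by move=> Kx Ky z pz; rewrite (siDl fP) (siZl fP) Kx// Ky// mulr0 addr0.
have K0 m : krylov m 0 by move=> y _; rewrite (si0l fP).
have K_mono m : krylov m `<=` krylov m.+1.
  by move=> x Kx y py; apply: Kx => i im; apply: py; exact: ltnW.
have K_T m x : (m < n)%N -> krylov m x -> krylov m.+1 ((Bs \o B) x).
  by move=> mn; exact: krylov_stable mn.
have K1 : (0 < n)%N -> krylov 1 ((Bs \o B) (u 0%N - us)).
  by move=> n0 y py; rewrite /= -r_error (krylov_residual (n := 1)) ?rn.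
have [c [Kc c_le]] := chebyshev_vector energyP T_lin T_sym D_lin T_D s_gt0 st
  energy_ge T_le D_error K_lin K0 K_mono K_T K1 (leqnn n).
set gm := (_ + _) / 2 in Kc.
have opt : gm ^+ 2 * energy (u n - us) (u n - us) <= energy c c.
  pose v := gm *: (u n - us) - c.
  have cE : c = gm *: (u n - us) - v by rewrite opprB addrC subrK.
  have ev : energy (u n - us) v = 0.
    (* Both summands are orthogonal to [r n]: the first is an increment, the second lies in
       [krylov n]. *)
    have -> : v = gm *: (u n - u 0%N) - (c - gm *: (u 0%N - us)).
      by rewrite opprB addrA -scalerDr subrKA.
    rewrite /energy -B_adj -r_error (siDr fP) (siZr fP) cg_orth_increment//.
    rewrite mulr0 add0r (siNr fP) (siC fP) Kc ?oppr0// => i lt_in.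
    by rewrite (siC fP) cg_orth.
  rewrite cE; move: (u n - us) v ev {cE} => e v ev.
  rewrite !(siE energyP) (siC energyP v) ev; have := si_ge0 energyP v; lra.
have t_gt0 : 0 < t by exact: lt_le_trans st.
(* Dropping the smaller power in [gm] costs the factor 2 of the final estimate. *)
have gm_ge : ((t + s) ^+ 2) ^+ n <= 2 * gm.
  by rewrite /gm mulrCA divff// mulr1 lerDl exprn_ge0// sqr_ge0.
move: gm gm_ge opt {Kc} => gm gm_ge opt.
have gm2 : ((t + s) ^+ 2) ^+ (2 * n) <= 4 * gm ^+ 2.
  rewrite (_ : 4 * _ = (2 * gm) ^+ 2); last by rewrite exprMn -natrX.
  have A_ge0 : 0 <= ((t + s) ^+ 2) ^+ n by rewrite exprn_ge0// sqr_ge0.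
  by rewrite mulnC exprM ler_pXn2r// nnegrE ?A_ge0//; exact: le_trans gm_ge.
have e_le : s ^+ 2 * f (u n - us) (u n - us) <= energy (u n - us) (u n - us).
  apply: B_ge => y By; rewrite (_ : u n - us = (u n - u 0%N) + (u 0%N - us)).
    by rewrite (siDl fP) cg_increment_kernel// D_error// addr0.
  by rewrite subrKA.
have e0_le := cg_image_le (u 0%N - us).
have W_ge0 : 0 <= (t ^+ 2 - s ^+ 2) ^+ (2 * n).
  by rewrite exprM exprn_ge0// sqr_ge0.
have A_ge0 : 0 <= ((t + s) ^+ 2) ^+ (2 * n) by rewrite exprn_ge0// sqr_ge0.
(* The chain passes from [|e_n|] to its energy by [s], to the energy of [c] by optimality, to that
   of [e_0] by the Chebyshev bound, and back to [|e_0|] by [t]. *)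
have step1 := ler_wpM2l A_ge0 e_le.
have step2 := ler_wpM2r (si_ge0 energyP (u n - us)) gm2.
have step3 := ler_wpM2l W_ge0 e0_le.
rewrite -/(energy _ _) in step3; lra.
Qed.

End Solution.
End ConjugateGradients.

(** * Convergence and solvability for the normal equation *)

Section NormalEquation.
Context {R : realType} {E : lmodType R}.
Variable f : E -> E -> R.
Hypothesis fP : semi_inner f.
Hypothesis f_definite : forall x, f x x = 0 -> x = 0.
Hypothesis f_complete : si_complete f.

Variables B Bs : E -> E.
Hypothesis B_lin : real_linear B.
Hypothesis Bs_lin : real_linear Bs.
Hypothesis B_adj : forall x y, f (Bs y) x = f y (B x).
Hypothesis B_le : forall x, f (B x) (B x) <= f x x.
Variable b : E.

(** The products of the residuals at [x n] with the residual [y] at [l] tend to [f y y] by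
    continuity and to [0] by Cauchy-Schwarz. *)
Lemma residual_cvg_solution (x : nat -> E) (l : E) : si_cvg f x l ->
  (fun n => f (Bs (B (x n) - b)) (Bs (B (x n) - b))) @ \oo --> (0 : R) ->
  Bs (B l - b) = 0.
Proof.
move=> xl r0; apply: f_definite; set y := Bs (B l - b).
have form z : f (Bs (B z - b)) y = f z (Bs (B y)) - f b (B y).
  by rewrite B_adj (siDl fP) (siNl fP) (siC fP z) B_adj (siC fP (B z)).
have lim1 : (fun n => f (Bs (B (x n) - b)) y) @ \oo --> f y y.
  rewrite [X in _ --> X]form; under eq_fun do rewrite form.
  by apply: cvgB; [exact: si_cvg_form|exact: cvg_cst].
have lim2 : (fun n => f (Bs (B (x n) - b)) y ^+ 2) @ \oo --> (0 : R).
  apply: (@squeeze_cvgr _ _ _ _ (cst 0)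
    (fun n => f (Bs (B (x n) - b)) (Bs (B (x n) - b)) * f y y)).
  - by near=> n; rewrite sqr_ge0 cauchy_schwarz.
  - exact: cvg_cst.
  - by rewrite -(mul0r (f y y)); apply: cvgMl.
apply/eqP; rewrite -sqrf_eq0; apply/eqP.
by apply: (cvg_unique _ _ lim2) => //; rewrite !expr2; apply: cvgM.
Unshelve. all: by end_near. Qed.

(** The sets where the squared residual is at most [1/(n+1)] are nested and convex and all meet a
    fixed ball, so the nested limit provides a solution. *)
Lemma bounded_residual_solvable (C : R) :
  (forall e, 0 < e -> exists2 x, f x x <= C &
    f (Bs (B x - b)) (Bs (B x - b)) <= e) ->
  exists l, Bs (B l - b) = 0.
Proof.
move=> bnd; pose g x := f (Bs (B x - b)) (Bs (B x - b)).
pose S n := [set x | g x <= n.+1%:R^-1].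
have [n m nm x /= gx|n x y /= gx gy|n|x [l [Sx xl _]]] :=
  nested_convex_limit fP f_complete (S := S) (C := C).
- by apply: le_trans gx _; rewrite lef_pV2 ?posrE// ler_nat ltnS.
- rewrite /S /= /g; have -> : Bs (B (2^-1 *: (x + y)) - b) =
      2^-1 *: (Bs (B x - b) + Bs (B y - b)).
    rewrite -(rlinD Bs_lin) -(rlinZ Bs_lin) (rlinZ B_lin) (rlinD B_lin).
    by congr Bs; rewrite addrACA -opprD [RHS]scalerDr scalerN scale_half_double.
  move: gx gy; rewrite /S /= /g; move: (Bs (B x - b)) (Bs (B y - b)) => v w.
  have := si_ge0 fP (v - w); rewrite !(siE fP) (siC fP w v).
  move: (n.+1%:R^-1) => a; lra.
- have n1_gt0 : 0 < n.+1%:R^-1 :> R by rewrite invr_gt0.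
  by have [x xC gx] := bnd _ n1_gt0; exists x.
exists l; apply: residual_cvg_solution xl _.
apply: (@squeeze_cvgr _ _ _ _ (cst 0) (fun n => n.+1%:R^-1)).
- by near=> n; rewrite (si_ge0 fP) (Sx n).
- exact: cvg_cst.
- exact: cvg_harmonic.
Unshelve. all: by end_near. Qed.

Variables (u r p : nat -> E).
Hypothesis r_def : forall n, r n = Bs (B (u n) - b).
Hypothesis p0 : r 0%N != 0 -> p 0%N = - r 0%N.
Hypothesis pS : forall n, r n.+1 != 0 ->
  p n.+1 = - r n.+1 + (f (r n.+1) (r n.+1) / f (r n) (r n)) *: p n.
Hypothesis uS : forall n, r n != 0 ->
  u n.+1 = u n + (f (r n) (r n) / f (B (p n)) (B (p n))) *: p n.
Hypothesis u_stop : forall n, r n = 0 -> u n.+1 = u n.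

Let r_cvg :
  (fun n => f (Bs (B (u n) - b)) (Bs (B (u n) - b))) @ \oo --> (0 : R).
Proof.
under eq_fun do rewrite -r_def.
exact: (cg_residual_cvg fP f_definite B_lin Bs_lin B_adj B_le
  r_def p0 pS uS u_stop).
Qed.

(** The decrease of the squared error serves as Cauchy modulus. The limit may differ from [us]; the
    last clause, which singles it out, is the kernel relation for the increments passed to the
    limit. *)
Lemma cg_cvg (us : E) : Bs (B us - b) = 0 -> exists l,
  [/\ si_cvg f u l, Bs (B l - b) = 0 &
    forall y, B y = 0 -> f (u 0%N - l) y = 0].
Proof.
move=> us_sol.
have decr n m : (n <= m)%N -> f (u m - u n) (u m - u n) <=
    f (u n - us) (u n - us) - f (u m - us) (u m - us).
  exact: (cg_error_decrease fP f_definite B_lin Bs_lin B_adj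
    r_def p0 pS uS u_stop us_sol).
pose e n := f (u n - us) (u n - us).
have e_nonincr n m : (n <= m)%N -> e m <= e n.
  by move=> /decr; have := si_ge0 fP (u m - u n); rewrite /e; lra.
have e_cvg : cvgn e.
  by apply: nonincreasing_is_cvgn => //; exists 0 => _ [n _ <-]; exact: si_ge0.
have [l ul] : exists l, si_cvg f u l.
  apply: (f_complete (e := fun n => e n - limn e)).
    by rewrite -(subrr (limn e)); apply: cvgB => //; exact: cvg_cst.
  move=> n m nm; apply: le_trans (decr _ _ nm) _; rewrite lerD2l lerN2.
  exact: nonincreasing_cvgn_ge.
exists l; split=> //; first exact: residual_cvg_solution ul r_cvg.
move=> y By; have h n : f (u n) y = f (u 0%N) y.
  have := cg_increment_kernel fP B_adj r_def p0 pS uS u_stop n By.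
  by rewrite (siDl fP) (siNl fP) => /eqP; rewrite subr_eq0 => /eqP.
rewrite (siDl fP) (siNl fP); apply/eqP; rewrite subr_eq0; apply/eqP.
have := si_cvg_form (y := y) fP ul; under eq_fun do rewrite h.
by move=> /(cvg_unique _ (cvg_cst _)) ->.
Qed.

Lemma cg_bounded_solvable (C : R) :
  (forall N, exists2 n, (N <= n)%N & f (u n) (u n) <= C) ->
  exists l, Bs (B l - b) = 0.
Proof.
move=> bnd; apply: (bounded_residual_solvable (C := C)) => e e0.
have [N _ rN] := cvgr_le _ r_cvg e e0.
by have [n Nn un] := bnd N; exists (u n) => //; exact: rN.
Qed.

(** Increments are orthogonal to the kernel, so [c |u_n - u_0|^2 <= |B (u_n - u_0)|^2 <= 2 J_n + 2
    J_0 <= 4 J_0]: the iterates are bounded and themselves produce a solution. *)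
Lemma cg_coercive_solvable (c : R) : 0 < c ->
  (forall x, (forall y, B y = 0 -> f x y = 0) -> c * f x x <= f (B x) (B x)) ->
  exists l, Bs (B l - b) = 0.
Proof.
move=> c0 coercive; pose J n := f (B (u n) - b) (B (u n) - b).
have J_le n : J n <= J 0%N.
  elim: n => // n IHn; apply: le_trans IHn.
  have := cg_functional_decrease fP f_definite B_lin Bs_lin B_adj B_le
    r_def p0 pS uS u_stop n.
  by move/le_trans; apply; rewrite lerBlDr lerDl (si_ge0 fP).
have incr n : f (u n - u 0%N) (u n - u 0%N) <= 4 * J 0%N / c.
  rewrite ler_pdivlMr// mulrC; apply: le_trans (coercive _ _) _.
    by move=> y; exact: (cg_increment_kernel fP B_adj r_def p0 pS uS u_stop).
  have -> : B (u n - u 0%N) = (B (u n) - b) - (B (u 0%N) - b).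
    by rewrite (rlinD B_lin) (rlinN B_lin) opprB subrKA.
  have := J_le n; rewrite /J; move: (B (u n) - b) (B (u 0%N) - b) => y z.
  have := si_ge0 fP (y + z); rewrite !(siE fP) (siC fP z y); lra.
apply: (cg_bounded_solvable
  (C := 2 * (4 * J 0%N / c) + 2 * f (u 0%N) (u 0%N))) => N.
have sqD y z : f (y + z) (y + z) <= 2 * f y y + 2 * f z z.
  by have := si_ge0 fP (y - z); rewrite !(siE fP) (siC fP z y); lra.
exists N => //; have := sqD (u N - u 0%N) (u 0%N); rewrite subrK.
by have := incr N; move: (4 * J 0%N / c) => d; lra.
Qed.

End NormalEquation.

(** * Hilbert spaces over either scalar field as real vector spaces *)

Section Scalars.
Context {R : realType} {k : scalar_kind}.
Local Notation K := (scalars R k).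
Local Notation re := (@scalar_re R k).

Definition scalar_of : R -> K :=
  match k with RealScalars => @idfun R | ComplexScalars => real_complex R end.

Lemma scalar_ofK a : re (scalar_of a) = a.
Proof. by rewrite /scalar_of; case: k. Qed.

Lemma scalar_ofD a b : scalar_of (a + b) = scalar_of a + scalar_of b.
Proof. by rewrite /scalar_of; case: k => //=; rewrite rmorphD. Qed.

Lemma scalar_ofM a b : scalar_of (a * b) = scalar_of a * scalar_of b.
Proof. by rewrite /scalar_of; case: k => //=; rewrite rmorphM. Qed.

Lemma scalar_of1 : scalar_of 1 = 1.
Proof. by rewrite /scalar_of; case: k. Qed.

Lemma scalar_ofV a : scalar_of a^-1 = (scalar_of a)^-1.
Proof. by rewrite /scalar_of; case: k => //=; rewrite fmorphV. Qed.

Lemma scalar_of_le a b : (scalar_of a <= scalar_of b) = (a <= b).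
Proof. by rewrite /scalar_of; case: k => //=; rewrite lecR. Qed.

Lemma scalar_of_lt a b : (scalar_of a < scalar_of b) = (a < b).
Proof. by rewrite /scalar_of; case: k => //=; rewrite ltcR. Qed.

Lemma scalar_reD x y : re (x + y) = re x + re y.
Proof. by case: k x y => //= -[a b] [c d]. Qed.

Lemma scalar_reZ a x : re (scalar_of a * x) = a * re x.
Proof.
by rewrite /scalar_of; case: k x => //= -[c d] /=; rewrite mul0r subr0.
Qed.

Lemma scalar_re_conj x : re (scalar_conj R k x) = re x.
Proof. by case: k x => //= -[c d]. Qed.

Lemma ge0_scalar_reK x : 0 <= x -> scalar_of (re x) = x.
Proof.
rewrite /scalar_of; case: k x => //= -[c d] /=.
by rewrite lecE /= => /andP[/eqP -> _].
Qed.

Lemma scalar_of0 : scalar_of 0 = 0.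
Proof. by rewrite /scalar_of; case: k. Qed.

Lemma scalar_re_ge0 x : 0 <= x -> 0 <= re x.
Proof. by move=> x_ge0; rewrite -scalar_of_le scalar_of0 ge0_scalar_reK. Qed.

Lemma scalar_re_le_norm x : re x <= re `|x|.
Proof.
case: k x => /= [x|[c d]]; first exact: ler_norm.
have normE : complex.Re `|Complex c d| = Num.sqrt (c ^+ 2 + d ^+ 2).
  by rewrite normc_def.
rewrite [leRHS]normE (le_trans (ler_norm c))// -sqrtr_sqr.
by rewrite ler_wsqrtr// lerDl sqr_ge0.
Qed.

End Scalars.

Section Realification.
Context {R : realType} {k : scalar_kind}.
Local Notation K := (scalars R k).
Local Notation emb := (@scalar_of R k).

(** A copy of [H], so that the real scalar multiplication does not clash with the one over [K]. *)
Definition realified (H : completeNormedModType K) : Type := H.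

Variable H : completeNormedModType K.

HB.instance Definition _ := GRing.Zmodule.on (realified H).

Let rscale (a : R) (x : realified H) : realified H := emb a *: (x : H).

Let rscaleA a b x : rscale a (rscale b x) = rscale (a * b) x.
Proof. by rewrite /rscale scalerA scalar_ofM. Qed.

Let rscale1 : left_id 1 rscale.
Proof. by move=> x; rewrite /rscale scalar_of1 scale1r. Qed.

Let rscaleDr : right_distributive rscale +%R.
Proof. by move=> a x y; rewrite /rscale scalerDr. Qed.

Let rscaleDl x : {morph rscale^~ x : a b / a + b}.
Proof. by move=> a b; rewrite /rscale scalar_ofD scalerDl. Qed.

HB.instance Definition _ := GRing.Zmodule_isLmodule.Build R (realified H)
  rscaleA rscale1 rscaleDr rscaleDl.

Lemma realified_scaleE (a : R) (x : realified H) :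
  a *: x = emb a *: (x : H).
Proof. by []. Qed.

End Realification.

(** * Convergence and orthogonal projections in a Hilbert space *)

Section HilbertSpace.
Context {R : realType} {k : scalar_kind}.
Local Notation K := (scalars R k).
Local Notation emb := (@scalar_of R k).
Context {H : completeNormedModType K}.
Variable dot : {dot H for @scalar_conj R k}.
Hypothesis dot_norm : forall x : H, dot x x = `|x| ^+ 2.
Local Notation E := (realified H).

Definition rdot (x y : E) : R := scalar_re (dot x y).

Lemma dotC x y : dot x y = scalar_conj R k (dot y x).
Proof. by rewrite hermC expr0 mul1r. Qed.

Lemma dotBl x y z : dot (x - y) z = dot x z - dot y z.
Proof. exact: linearBl. Qed.

Lemma dotBr x y z : dot z (x - y) = dot z x - dot z y.
Proof. exact: linearBr. Qed.

Lemma dotDl x y z : dot (x + y) z = dot x z + dot y z.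
Proof. exact: linearDl. Qed.

Lemma dotZl a x y : dot (a *: x) y = a * dot x y.
Proof. exact: linearZl_LR. Qed.

Lemma dot0l x : dot 0 x = 0.
Proof. exact: linear0l. Qed.

Lemma dotNr x y : dot y (- x) = - dot y x.
Proof. exact: linearNr. Qed.

Lemma rdotP : semi_inner rdot.
Proof.
split=> [x y|x y z|a x y|x].
- by rewrite /rdot dotC scalar_re_conj.
- by rewrite /rdot dotDl scalar_reD.
- by rewrite /rdot realified_scaleE dotZl scalar_reZ.
- by rewrite /rdot dot_norm scalar_re_ge0// exprn_ge0.
Qed.

Lemma norm_rnorm (x : H) : `|x| = emb (rnorm x).
Proof. by rewrite ge0_scalar_reK. Qed.

Lemma rnorm_ge0 (x : H) : 0 <= rnorm x.
Proof. exact: scalar_re_ge0. Qed.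

Lemma rdot_norm (x : H) : rdot x x = rnorm x ^+ 2.
Proof. by rewrite /rdot dot_norm norm_rnorm expr2 -scalar_ofM scalar_ofK. Qed.

Lemma rdot_definite (x : E) : rdot x x = 0 -> x = 0.
Proof.
move=> /eqP; rewrite rdot_norm sqrf_eq0 => /eqP x0.
by apply/eqP; rewrite -(normr_eq0 (x : H)) norm_rnorm x0 scalar_of0.
Qed.

Lemma rdot_cvgP (x : nat -> E) (l : E) :
  si_cvg rdot x l <-> (x : nat -> H) @ \oo --> (l : H).
Proof.
split=> [xl|xl].
  apply/cvgrPdist_lt => e e0.
  have re0 : 0 < scalar_re e.
    by rewrite -(@scalar_of_lt R k) scalar_of0 ge0_scalar_reK ?ltW.
  have re2 : 0 < scalar_re e ^+ 2 by rewrite exprn_gt0.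
  near=> n; rewrite distrC norm_rnorm -(ge0_scalar_reK (ltW e0)) scalar_of_lt.
  rewrite -(@ltr_pXn2r _ 2)// ?nnegrE ?rnorm_ge0 ?(ltW re0)// -rdot_norm.
  rewrite -[ltLHS]ger0_norm ?(si_ge0 rdotP)//.
  by near: n; move/cvgr0Pnorm_lt: xl; apply.
apply/cvgr0Pnorm_lt => e e0; rewrite /=.
have se : 0 < emb (Num.sqrt e).
  by rewrite -(@scalar_of0 R k) scalar_of_lt sqrtr_gt0.
near=> n; rewrite ger0_norm ?(si_ge0 rdotP)// rdot_norm.
rewrite -[ltRHS]sqr_sqrtr ?(ltW e0)// ltr_pXn2r ?nnegrE ?rnorm_ge0 ?sqrtr_ge0//.
rewrite -(@scalar_of_lt R k) -norm_rnorm -normrN opprB.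
by near: n; move/cvgrPdist_lt: xl; apply.
Unshelve. all: by end_near. Qed.

Lemma rdot_complete : si_complete rdot.
Proof.
move=> x e e_cvg0 x_cauchy.
have x_cvg : cvgn (x : nat -> H).
  apply: cauchy_cvg; apply: cauchy_exP => eps eps0.
  have re0 : 0 < scalar_re eps.
    by rewrite -(@scalar_of_lt R k) scalar_of0 ge0_scalar_reK ?ltW.
  have re2 : 0 < scalar_re eps ^+ 2 by rewrite exprn_gt0.
  have [N _ eN] := cvgr_lt _ e_cvg0 _ re2.
  exists (x N); exists N => // n /= Nn; rewrite -ball_normE /=.
  rewrite -normrN opprB norm_rnorm -(ge0_scalar_reK (ltW eps0)) scalar_of_lt.
  rewrite -(@ltr_pXn2r _ 2)// ?nnegrE ?rnorm_ge0 ?(ltW re0)// -rdot_norm.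
  exact: le_lt_trans (x_cauchy _ _ Nn) (eN N (leqnn N)).
by exists (limn (x : nat -> H)); apply/rdot_cvgP.
Qed.

(** Taking the real part keeps the norm but weakens orthogonality. Testing all multiples recovers
    it: for [dot x y] nonzero, its inverse as [c] would give the value [1]. *)
Lemma rdot_eq0 (x y : H) : (forall c : K, rdot (c *: x) y = 0) -> dot x y = 0.
Proof.
move=> h; apply/eqP; apply/negP => /negP xy; have := h (dot x y)^-1.
rewrite /rdot dotZl mulVf// -(@scalar_of1 R k) scalar_ofK => /eqP.
by rewrite oner_eq0.
Qed.

Lemma dot_eq0C (x y : H) : dot x y = 0 -> dot y x = 0.
Proof. by rewrite (dotC y) => ->; rewrite rmorph0. Qed.

(** Two points with the defining property, tested against each other, have a difference orthogonal
    to itself. The set is arbitrary, so this covers subspaces, [W] and the set of minimizers. *)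
Lemma orth_proj_eq (S : set H) (x q : H) :
  S q -> (forall s, S s -> dot (x - q) (s - q) = 0) -> orth_proj dot S x = q.
Proof.
move=> Sq q_orth; rewrite /orth_proj.
have : [set p | S p /\ forall s, S s -> dot (x - p) (s - p) = 0] q by split.
move=> /(xgetI x)[Sp p_orth].
move: (xget _ _) Sp p_orth => p Sp p_orth.
have h1 := p_orth _ Sq; have h2 := q_orth _ Sp.
have pq0 : dot (p - q) (p - q) = 0.
  have {1}-> : p - q = (x - q) - (x - p) by rewrite opprB [RHS]addrC subrKA.
  by rewrite dotBl h2 -(opprB q p) dotNr h1 oppr0 subr0.
by apply/eqP; rewrite -subr_eq0 -(normr_eq0 (p - q)) -sqrf_eq0 -dot_norm pq0.
Qed.

Definition seq_closed (S : set H) :=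
  forall (x : nat -> E) (l : E), (forall n, S (x n)) -> si_cvg rdot x l -> S l.

Lemma closed_seq_closed (S : set H) : closed S -> seq_closed S.
Proof.
move=> S_closed x l Sx /rdot_cvgP xl; apply: closed_cvg S_closed _ _ xl.
by near=> n; exact: Sx.
Unshelve. all: by end_near. Qed.

Lemma linear_subspaceP (S : set H) : linear_subspace S ->
  S 0 /\ forall (a : K) x y, S x -> S y -> S (a *: x + y).
Proof.
case=> [/set_mem S0 S_lin]; split=> // a x y Sx Sy.
by apply: set_mem; apply: S_lin; apply: mem_set.
Qed.

Section Subspace.
Variable S : set H.
Hypothesis S_lin : linear_subspace S.
Hypothesis S_closed : seq_closed S.
Local Notation P := (orth_proj dot S).

Let S0 : S 0. Proof. by case: (linear_subspaceP S_lin). Qed.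

Let Slin (a : K) x y : S x -> S y -> S (a *: x + y).
Proof. by move: a x y; case: (linear_subspaceP S_lin). Qed.

Lemma subspaceZ (a : K) x : S x -> S (a *: x).
Proof. by move=> Sx; rewrite -[_ *: _]addr0; exact: Slin. Qed.

Lemma subspaceD x y : S x -> S y -> S (x + y).
Proof. by move=> Sx Sy; rewrite -[x]scale1r; exact: Slin. Qed.

Lemma subspaceN x : S x -> S (- x).
Proof. by move=> Sx; rewrite -scaleN1r; exact: subspaceZ. Qed.

Lemma subspaceB x y : S x -> S y -> S (x - y).
Proof. by move=> Sx Sy; apply: subspaceD => //; exact: subspaceN. Qed.

Lemma orth_proj_subspace_eq x q :
  S q -> (forall s, S s -> dot (x - q) s = 0) -> P x = q.
Proof.
move=> Sq q_orth; apply: orth_proj_eq => // s Ss.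
by apply: q_orth; exact: subspaceB.
Qed.

(** Existence comes from the real decomposition; since [S] is stable under scalars of [K], real
    orthogonality improves to orthogonality over [K]. *)
Let proj_spec x : S (P x) /\ forall s, S s -> dot (x - P x) s = 0.
Proof.
have [q Sq q_orth] :
    exists2 q : E, S q & forall s : E, S s -> rdot ((x : E) - q) s = 0.
  apply: (orthogonal_decomposition rdotP rdot_complete) => //.
  by move=> a y z Sy Sz; rewrite realified_scaleE; exact: Slin.
have q_dot s : S s -> dot (x - q) s = 0.
  move=> Ss; apply/dot_eq0C/rdot_eq0 => c.
  by rewrite (siC rdotP); apply: q_orth; exact: subspaceZ.
by rewrite (orth_proj_subspace_eq Sq q_dot).
Qed.

Lemma proj_mem x : S (P x). Proof. by case: (proj_spec x). Qed.

Lemma proj_orth x s : S s -> dot (x - P x) s = 0.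
Proof. by case: (proj_spec x) => _; exact. Qed.

Lemma proj_id x : S x -> P x = x.
Proof.
move=> Sx; apply: orth_proj_subspace_eq => // s _.
by rewrite subrr dot0l.
Qed.

Lemma proj_rdot x s : S s -> rdot (P x) s = rdot x s.
Proof.
move=> /(proj_orth x); rewrite dotBl => /eqP; rewrite subr_eq0 => /eqP.
by rewrite /rdot => ->.
Qed.

Lemma proj_linear : real_linear (P : E -> E).
Proof.
move=> a x y; apply: orth_proj_subspace_eq => [|s Ss].
  by rewrite !realified_scaleE; apply: Slin; exact: proj_mem.
rewrite !realified_scaleE.
rewrite opprD addrACA -scalerBr dotDl dotZl !proj_orth//.
by rewrite mulr0 addr0.
Qed.

Lemma proj_sym x y : rdot (P x) y = rdot x (P y).
Proof.
rewrite -[RHS]proj_rdot; last exact: proj_mem.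
by rewrite (siC rdotP) -proj_rdot ?(siC rdotP (P y))//; exact: proj_mem.
Qed.

Lemma proj_pythagoras x :
  rdot x x = rdot (P x) (P x) + rdot (x - P x : H) (x - P x : H).
Proof.
have h := proj_rdot x (proj_mem x).
rewrite !(siE rdotP) (siC rdotP (P x) x) -h; ring.
Qed.

Lemma proj_le x : rdot (P x) (P x) <= rdot x x.
Proof. by rewrite (proj_pythagoras x) lerDl (si_ge0 rdotP). Qed.

Lemma proj_orthC x : orth_proj dot (orth dot S) x = x - P x.
Proof.
apply: orth_proj_eq => [s Ss|s So]; first exact: proj_orth.
have -> : x - (x - P x) = P x by rewrite opprB addrC subrK.
rewrite dotBr.
rewrite dot_eq0C ?(So _ (proj_mem x))// dot_eq0C ?proj_orth ?subrr//.
exact: proj_mem.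
Qed.

Lemma projC_linear : real_linear (fun x : E => x - P x : E).
Proof. by move=> a x y; rewrite proj_linear scalerBr opprD addrACA. Qed.

Lemma projC_sym x y : rdot (x - P x) y = rdot x (y - P y).
Proof. by rewrite !(siE rdotP) proj_sym. Qed.

Lemma projC_le x : rdot (x - P x) (x - P x) <= rdot x x.
Proof. by rewrite (proj_pythagoras x) lerDr (si_ge0 rdotP). Qed.

Lemma proj_projC x : P (x - P x) = 0.
Proof.
by apply: orth_proj_subspace_eq => // s Ss; rewrite subr0 proj_orth.
Qed.

End Subspace.
End HilbertSpace.

(** * The least-squares problem of a subspace and an affine subspace *)

Section LeastSquares.
Context {R : realType} {k : scalar_kind}.
Local Notation K := (scalars R k).
Local Notation emb := (@scalar_of R k).
Context {H : completeNormedModType K}.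
Variable dot : {dot H for @scalar_conj R k}.
Hypothesis dot_norm : forall x : H, dot x x = `|x| ^+ 2.
Local Notation E := (realified H).
Local Notation rd := (rdot dot).
Variables U V W : set H.
Hypothesis U_lin : linear_subspace U.
Hypothesis U_closed : seq_closed dot U.
Hypothesis V_lin : linear_subspace V.
Hypothesis V_closed : seq_closed dot V.
Variable w : H.
Hypothesis W_def : W = [set w + v | v in V].

Local Notation PU := (orth_proj dot U).
Local Notation PV := (orth_proj dot V).
Local Notation PW := (orth_proj dot W).

Let rP : semi_inner rd := rdotP dot_norm.
Let Q (x : E) : E := x - PV x.
Let B (x : E) : E := Q (PU x).
Let Bs (x : E) : E := PU (Q x).
Let b : E := Q w.

Let Q_lin : real_linear Q. Proof. exact: projC_linear. Qed.
Let PU_lin : real_linear (PU : E -> E). Proof. exact: proj_linear. Qed.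

Let B_lin : real_linear B.
Proof. by move=> a x y; rewrite /B PU_lin Q_lin. Qed.

Let Bs_lin : real_linear Bs.
Proof. by move=> a x y; rewrite /Bs Q_lin PU_lin. Qed.

Let B_adj x y : rd (Bs y) x = rd y (B x).
Proof. by rewrite /Bs /B proj_sym// /Q projC_sym. Qed.

Let B_le x : rd (B x) (B x) <= rd x x.
Proof. by rewrite (le_trans (projC_le _ _ _ _))// proj_le. Qed.

Let Q_idem x : Q (Q x) = Q x.
Proof. by rewrite /Q proj_projC// subr0. Qed.

Let BU x : U x -> B x = Q x.
Proof. by move=> Ux; rewrite /B proj_id. Qed.

Let PW_eq x : PW x = w + PV (x - w).
Proof.
apply: orth_proj_eq => //; rewrite W_def.
  by exists (PV (x - w)) => //; exact: proj_mem.
move=> _ [v Vv <-]; rewrite opprD addrACA subrr add0r addrA.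
by rewrite proj_orth//; apply: subspaceB => //; exact: proj_mem.
Qed.

Let sub_PW x : x - PW x = Q x - b.
Proof.
rewrite PW_eq /b -[Q x - Q w]/(Q x - Q w) -(rlinN Q_lin) -(rlinD Q_lin) /Q.
by rewrite opprD addrA.
Qed.

Let residual x : U x -> x - PU (PW x) = Bs (B x - b).
Proof.
move=> Ux; rewrite (BU Ux) /Bs (rlinD Q_lin) (rlinN Q_lin) /b !Q_idem.
rewrite -/b -sub_PW.
by rewrite (rlinD PU_lin) (rlinN PU_lin) (proj_id _ _ Ux).
Qed.

Let ker_BsB x : Bs (B x) = 0 -> B x = 0.
Proof.
move=> h; apply: (rdot_definite dot_norm).
by rewrite -B_adj h (si0l rP).
Qed.

Let ker_B x : U x -> (B x = 0 <-> V x).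
Proof.
move=> Ux; rewrite (BU Ux) /Q; split=> [/eqP|Vx].
  by rewrite subr_eq0 => /eqP ->; exact: proj_mem.
by rewrite proj_id// subrr.
Qed.

Let functional_shift x y : rd (B (x + y) - b) (B (x + y) - b) =
  rd (B x - b) (B x - b) + 2 * rd (Bs (B x - b)) y + rd (B y) (B y).
Proof.
rewrite (rlinD B_lin) addrAC B_adj; move: (B x - b) (B y) => c d.
by rewrite !(siE rP) (siC rP d); ring.
Qed.

Let functional_norm x : U x -> rd (B x - b) (B x - b) = rnorm (x - PW x) ^+ 2.
Proof. by move=> Ux; rewrite (BU Ux) -sub_PW -(rdot_norm dot_norm). Qed.

(** Comparing [x] with [x - r], where [r] is the residual, gives
    [0 <= -2 |r|^2 + |B r|^2 <= -|r|^2]. Conversely, a vanishing residual removes the linear term of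
    the functional. *)
Lemma minimizersP x :
  minimizers dot U W x <-> U x /\ Bs (B x - b) = 0.
Proof.
rewrite /minimizers /=; set D := [set rnorm (v - PW v) | v in U].
have D_lb : has_lbound D by exists 0 => _ [v _ <-]; exact: rnorm_ge0.
split=> -[Ux hx]; split=> //.
  apply: (rdot_definite dot_norm); set r := Bs _; apply/eqP.
  rewrite eq_le (si_ge0 rP) andbT.
  have Ur : U r by exact: proj_mem.
  have Uxr : U (x + (- r)) by exact: subspaceB.
  have := functional_shift x (- r); rewrite -/r !functional_norm//.
  have -> : rd (B (- r)) (B (- r)) = rd (B r) (B r).
    by rewrite (rlinN B_lin) (siNl rP) (siNr rP) opprK.
  rewrite (siNr rP) => h; have := B_le r.
  have : rnorm (x - PW x) ^+ 2 <= rnorm (x - r - PW (x - r)) ^+ 2.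
    rewrite ler_pXn2r ?nnegrE ?rnorm_ge0// hx; apply: ge_inf => //.
    by exists (x - r).
  by rewrite h; lra.
apply/eqP; rewrite eq_le; apply/andP; split; last first.
  by apply: ge_inf => //; exists x.
apply: lb_le_inf; first by exists (rnorm (x - PW x)), x.
move=> _ [v Uv <-]; rewrite -(@ler_pXn2r _ 2) ?nnegrE ?rnorm_ge0//.
rewrite -!functional_norm// -[v in leRHS](subrKC x) functional_shift hx.
by rewrite (si0l rP) mulr0 addr0 lerDl (si_ge0 rP).
Qed.

(** * The given iteration as conjugate gradients, and its limit *)

Variables (u0 : H) (u r p : nat -> H).
Hypothesis U_u0 : U u0.
Hypothesis cg : cg_iteration dot U W V u0 u r p.

Let quotE (x y : H) : `|x| ^+ 2 / `|y| ^+ 2 = emb (rd x x / rd y y).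
Proof.
rewrite !(rdot_norm dot_norm) !(norm_rnorm x) !(norm_rnorm y).
by rewrite scalar_ofM scalar_ofV !expr2 !scalar_ofM.
Qed.

Let u_stop n : r n = 0 -> u n.+1 = u n.
Proof. by case: cg => _ _ _ _ -> ->; rewrite eqxx. Qed.

Let r_stop n : r n = 0 -> r n.+1 = 0.
Proof. by move=> rn; case: cg => _ rE _ _ _; rewrite rE u_stop// -rE. Qed.

Let mem n : U (u n) /\ (r n != 0 -> U (p n)).
Proof.
case: cg => u0E rE p0 pS uS.
have Ur m : U (u m) -> U (r m).
  by move=> Um; rewrite rE; apply: subspaceB => //; exact: proj_mem.
elim: n => [|n [Un Upn]].
  split=> [|r0]; first by rewrite u0E.
  by rewrite p0//; apply/(subspaceN U_lin)/Ur; rewrite u0E.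
have US : U (u n.+1).
  rewrite uS; case: eqP => [//|/eqP rn].
  by apply: subspaceD => //; apply: subspaceZ => //; exact: Upn.
split=> // rS; rewrite pS//; apply: subspaceD => //.
  by apply: subspaceN => //; exact: Ur.
apply: subspaceZ => //; apply: Upn; apply: contra_neq rS; exact: r_stop.
Qed.

Let Uu n : U (u n). Proof. by case: (mem n). Qed.

Let r_def n : r n = Bs (B (u n) - b).
Proof. by case: cg => _ rE _ _ _; rewrite rE; exact: residual. Qed.

Let p0 : r 0%N != 0 -> p 0%N = - r 0%N. Proof. by case: cg. Qed.

Let pS n : r n.+1 != 0 ->
  p n.+1 = - r n.+1 + (rd (r n.+1) (r n.+1) / rd (r n) (r n)) *: (p n : E).
Proof.
by move=> rn; case: cg => _ _ _ h _; rewrite h// quotE.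
Qed.

Let uS n : r n != 0 -> u n.+1 =
  u n + (rd (r n) (r n) / rd (B (p n)) (B (p n))) *: (p n : E).
Proof.
move=> rn; case: cg => _ _ _ _ h; rewrite h (negbTE rn) quotE.
by rewrite (proj_orthC dot_norm V_lin V_closed) (BU (proj2 (mem n) rn)).
Qed.

Let definite := rdot_definite dot_norm.
Let complete := rdot_complete dot_norm.

Let u0E : u 0%N = u0. Proof. by case: cg. Qed.

(** Any minimizer differs from the limit [l] by a vector of [U] in the kernel of [B], that is, of
    the intersection of [U] and [V]. This is a subspace over [K] to which [u0 - l] is orthogonal, so
    [l] is the projection of [u0]. *)
Let limit_spec us : Bs (B us - b) = 0 -> exists l : E,
  [/\ si_cvg rd u l, minimizers dot U W l,
    orth_proj dot (minimizers dot U W) u0 = l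
   & forall y, B y = 0 -> rd (u 0%N - l) y = 0].
Proof.
move=> us_sol; have [l [ul l_sol l_orth]] :=
  cg_cvg rP definite complete B_lin Bs_lin B_adj B_le
    r_def p0 pS uS u_stop us_sol.
have Ul : U l by exact: U_closed ul.
have Ml : minimizers dot U W l by apply/minimizersP.
exists l; split=> //; apply: orth_proj_eq => // s /minimizersP[Us s_sol].
have Usl : U (s - l) by exact: subspaceB.
have Bsl : B (s - l) = 0.
  apply: ker_BsB; rewrite (_ : B (s - l) = (B s - b) - (B l - b)).
    by rewrite (rlinD Bs_lin) (rlinN Bs_lin) s_sol l_sol subrr.
  rewrite (rlinD B_lin) (rlinN B_lin); move: (B s) (B l) b => y z d.
  by rewrite opprB subrKA.
apply/dot_eq0C/rdot_eq0 => c; rewrite (siC rP) -u0E; apply: l_orth.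
apply/ker_B; first exact: subspaceZ.
by apply: subspaceZ => //; apply/ker_B.
Qed.

(** A solution of the normal equation may lie outside [U], but [B] sees only its projection to
    [U]. *)
Let solution_minimizer l : Bs (B l - b) = 0 -> minimizers dot U W (PU l).
Proof.
move=> l_sol; apply/minimizersP; split; first exact: proj_mem.
by rewrite {1}/B proj_id//; exact: proj_mem.
Qed.

Lemma cg_iteration_cvg : minimizers dot U W !=set0 ->
  u @ \oo --> orth_proj dot (minimizers dot U W) u0.
Proof.
move=> [us /minimizersP[_ us_sol]].
by have [l [ul _ -> _]] := limit_spec us_sol; apply/(rdot_cvgP dot_norm).
Qed.

Lemma cg_iteration_diverge : minimizers dot U W = set0 ->
  (fun n => rnorm (u n)) @ \oo --> +oo.
Proof.
move=> M0; apply/cvgryPge => A; apply: contrapT => notA.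
have [l l_sol] : exists l, Bs (B l - b) = 0.
  apply: (cg_bounded_solvable (C := A ^+ 2) rP definite complete B_lin Bs_lin
    B_adj B_le r_def p0 pS uS u_stop) => N.
  apply: contrapT => noN; apply: notA; exists N => // n /= Nn.
  rewrite leNgt; apply/negP => unA; apply: noN; exists n => //.
  rewrite (rdot_norm dot_norm) ler_pXn2r ?nnegrE ?rnorm_ge0 ?ltW//.
  exact: le_lt_trans (rnorm_ge0 _) unA.
by have := solution_minimizer l_sol; rewrite M0.
Qed.

(** * Operator bounds from the two angles *)

Let rnormZ a (x : E) : 0 <= a -> rnorm (a *: x : H) = a * rnorm (x : H).
Proof.
move=> a0; apply/eqP; rewrite -(@eqrXn2 _ 2)// ?mulr_ge0 ?rnorm_ge0//.
by rewrite exprMn -!(rdot_norm dot_norm) (siZl rP) (siZr rP) mulrA expr2.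
Qed.

Let rnorm_gt0 (x : H) : x != 0 -> 0 < rnorm x.
Proof.
move=> x0; rewrite lt_neqAle rnorm_ge0 andbT eq_sym; apply: contra_neq x0 => x0.
by apply: definite; rewrite (rdot_norm dot_norm) x0 expr0n.
Qed.

Let rnorm_unit (x : E) : x != 0 -> rnorm ((rnorm (x : H))^-1 *: x : H) = 1.
Proof.
by move=> /rnorm_gt0 x0; rewrite rnormZ ?invr_ge0 ?rnorm_ge0// mulVf// gt_eqF.
Qed.

Let Bs_le x : rd (Bs x) (Bs x) <= rd x x.
Proof. by rewrite (le_trans (proj_le _ _ _ _))// projC_le. Qed.

Let tp := op_norm (PU \o orth_proj dot (orth dot V)).

Let tp_sup : has_sup [set rnorm ((PU \o orth_proj dot (orth dot V)) x) |
  x in [set x | rnorm x <= 1]].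
Proof.
split.
  exists (rnorm (Bs 0)), 0 => //=; last by rewrite proj_orthC.
  by rewrite /rnorm normr0 /=; case: (k).
exists 1 => _ [x /= x1 <-]; rewrite proj_orthC//.
rewrite -(@ler_pXn2r _ 2) ?nnegrE ?rnorm_ge0// -(rdot_norm dot_norm).
rewrite (le_trans (Bs_le x))// (rdot_norm dot_norm) expr1n.
by rewrite expr_le1 ?rnorm_ge0.
Qed.

Let tp_ge (x : H) : rnorm x <= 1 -> rnorm (Bs x : H) <= tp.
Proof.
by move=> x1; apply: sup_upper_bound => //; exists x => //=; rewrite proj_orthC.
Qed.

Let tp_ge0 : 0 <= tp.
Proof.
apply: le_trans (tp_ge (x := 0) _); first exact: rnorm_ge0.
by rewrite /rnorm normr0 /=; case: (k).
Qed.

Let tp_le1 : tp <= 1.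
Proof.
apply: ge_sup; first by case: tp_sup.
move=> _ [x /= x1 <-]; rewrite proj_orthC//.
rewrite -(@ler_pXn2r _ 2) ?nnegrE ?rnorm_ge0// -(rdot_norm dot_norm).
rewrite (le_trans (Bs_le x))// (rdot_norm dot_norm) expr1n.
by rewrite expr_le1 ?rnorm_ge0.
Qed.

Let Bs_tp x : rd (Bs x) (Bs x) <= tp ^+ 2 * rd x x.
Proof.
have [->|x0] := eqVneq x 0.
  by rewrite (rlin0 Bs_lin) !(si0l rP) mulr0.
have nx := rnorm_gt0 x0.
have := tp_ge (x := (rnorm (x : H))^-1 *: x).
rewrite rnorm_unit// => /(_ (lexx _)).
rewrite (rlinZ Bs_lin) rnormZ ?invr_ge0 ?rnorm_ge0// ler_pdivrMl// => h.
rewrite !(rdot_norm dot_norm) -exprMn ler_pXn2r ?nnegrE ?mulr_ge0 ?rnorm_ge0//.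
by rewrite mulrC.
Qed.

Lemma sin_theta_p : sin (theta_p dot U V) = tp.
Proof.
by rewrite /theta_p asinK// in_itv/= tp_le1 andbT (le_trans _ tp_ge0)// lerN10.
Qed.

Let U0 := U `&` orth dot (U `&` V).
Let V0 := V `&` orth dot (U `&` V).
Let F := [set c : R | exists x y,
  [/\ U0 x, V0 y, rnorm x = 1, rnorm y = 1 & c = rabs (dot x y)]].

Let F_le1 : ubound F 1.
Proof.
move=> _ [x [y [_ _ x1 y1 ->]]]; set d := dot x y.
have [d0|d_neq0] := eqVneq d 0.
  by rewrite /rabs d0 normr0; rewrite /scalar_re; case: (k) => /=; rewrite ler01.
(* Multiplying [x] by this phase makes the real part of the inner product equal to the modulus of
   [d]. *)
pose z := (`|d| / d) *: x.
have zy : rd z y = rabs d by rewrite /rdot dotZl divfK.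
have zz : rd z z = 1.
  rewrite (rdot_norm dot_norm) /rnorm normrZ normrM normfV normr_id.
  by rewrite divff ?normr_eq0// mul1r -/(rnorm x) x1 expr1n.
have := cauchy_schwarz rP z y.
rewrite zz zy (rdot_norm dot_norm y) y1 expr1n mul1r.
by rewrite expr_le1// scalar_re_ge0.
Qed.

Let cf := sup F.

Let cf_le1 : cf <= 1.
Proof.
rewrite /cf; have [->|F0] := eqVneq F set0; first by rewrite sup0.
by apply: ge_sup F_le1; apply/set0P.
Qed.

Let cf_ge c : F c -> c <= cf.
Proof.
by move=> Fc; apply: ub_le_sup => //; exists 1; exact: F_le1.
Qed.

Let cf_ge0 : 0 <= cf.
Proof.
have [F0|] := eqVneq F set0; first by rewrite /cf F0 sup0.
move=> /set0P[c Fc]; apply: le_trans (cf_ge Fc).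
by case: Fc => x [y [_ _ _ _ ->]]; rewrite scalar_re_ge0.
Qed.

(** [PV x] inherits orthogonality to the intersection of [U] and [V], so the normalised pair [x],
    [PV x] competes in [F]: [|PV x|^2 = <x, PV x> <= cf |x| |PV x|]. *)
Let PV_cf x : U0 x -> rd (PV x) (PV x) <= cf ^+ 2 * rd x x.
Proof.
move=> [Ux x_orth]; have [->|Px0] := eqVneq (PV x) 0.
  by rewrite (si0l rP) mulr_ge0 ?sqr_ge0// (si_ge0 rP).
have x0 : x != 0.
  apply: contra_neq Px0 => ->.
  exact: (rlin0 (proj_linear dot_norm V_lin V_closed)).
have nx := rnorm_gt0 x0; have nP := rnorm_gt0 Px0.
have VPx : V (PV x) by exact: proj_mem.
have F_mem : F (rabs (dot ((rnorm x)^-1 *: (x : E) : H)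
    ((rnorm (PV x))^-1 *: (PV x : E) : H))).
  exists ((rnorm x)^-1 *: (x : E)), ((rnorm (PV x))^-1 *: (PV x : E)).
  split; rewrite ?rnorm_unit//; split.
  - exact: subspaceZ.
  - by move=> y UVy; rewrite realified_scaleE dotZl x_orth ?mulr0.
  - exact: subspaceZ.
  - move=> y UVy; rewrite realified_scaleE dotZl.
    have := proj_orth dot_norm V_lin V_closed x (proj2 UVy).
    rewrite dotBl x_orth// sub0r => /eqP; rewrite oppr_eq0 => /eqP ->.
    by rewrite mulr0.
have h : rd ((rnorm x)^-1 *: (x : E)) ((rnorm (PV x))^-1 *: (PV x : E)) <= cf.
  exact: le_trans (scalar_re_le_norm _) (cf_ge F_mem).
have xPx : rd x (PV x) = rnorm (PV x) ^+ 2.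
  by rewrite -(proj_rdot dot_norm V_lin V_closed x VPx) (rdot_norm dot_norm).
move: h; rewrite (siZl rP) (siZr rP) xPx expr2 mulKf ?gt_eqF//.
rewrite ler_pdivrMl// => h; rewrite !(rdot_norm dot_norm) -exprMn.
by rewrite ler_pXn2r ?nnegrE ?mulr_ge0 ?rnorm_ge0// mulrC.
Qed.

Let sf := sin (friedrichs_angle dot U V).

Let friedrichsE : friedrichs_angle dot U V = acos cf.
Proof. by []. Qed.

Let cf_itv : -1 <= cf <= 1.
Proof. by rewrite cf_le1 andbT (le_trans _ cf_ge0)// lerN10. Qed.

Let sf_sqr : sf ^+ 2 = 1 - cf ^+ 2.
Proof.
by rewrite /sf friedrichsE sin_acos// sqr_sqrtr// subr_ge0 expr_le1.
Qed.

Let sf_gt0 : 0 < friedrichs_angle dot U V -> 0 < sf.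
Proof.
move=> theta_gt0; rewrite /sf friedrichsE sin_acos// sqrtr_gt0 subr_gt0.
rewrite expr_lt1//.
rewrite lt_neqAle cf_le1 andbT; apply: contraTneq theta_gt0 => cf1.
by rewrite friedrichsE cf1 acos1 ltxx.
Qed.

(* The orthogonal complement of the kernel of [B = P_(V^perp) P_U] is
   [U `&` orth (U `&` V)]. *)
Let B_coercive x : (forall y, B y = 0 -> rd x y = 0) ->
  sf ^+ 2 * rd x x <= rd (B x) (B x).
Proof.
move=> x_orth; have Ux : U x.
  (* [B] vanishes on the complement of [U], hence [x] has no component there. *)
  have B0 : B (x - PU x) = 0 by rewrite /B proj_projC// (rlin0 Q_lin).
  have e : x - PU x = 0.
    apply: definite; rewrite {1}(siDl rP) (siNl rP) (x_orth _ B0).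
    by rewrite (proj_sym dot_norm U_lin U_closed) proj_projC// (si0r rP) subrr.
  by move/eqP: e; rewrite subr_eq0 => /eqP ->; exact: proj_mem.
have U0x : U0 x.
  split=> // y [Uy Vy]; apply/dot_eq0C/rdot_eq0 => c; rewrite (siC rP).
  by apply/x_orth/ker_B; exact: subspaceZ.
rewrite sf_sqr (BU Ux); have := PV_cf U0x.
have := proj_pythagoras dot_norm V_lin V_closed x; rewrite -/(Q x).
by rewrite mulrBl mul1r; lra.
Qed.

Lemma cg_iteration_rate :
  let theta_f := friedrichs_angle dot U V in
  let kappa := sin (theta_p dot U V) / sin theta_f in
  0 < theta_f -> minimizers dot U W !=set0 /\
    forall n, rnorm (u n - orth_proj dot (minimizers dot U W) u0) <=
      2 * kappa * (1 - 2 / (kappa + 1)) ^+ n *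
      rnorm (u 0%N - orth_proj dot (minimizers dot U W) u0).
Proof.
move=> theta_f kappa /sf_gt0 s_gt0.
have sf2_gt0 : 0 < sf ^+ 2 by rewrite exprn_gt0.
have [us us_sol] :=
  cg_coercive_solvable rP definite complete B_lin Bs_lin B_adj B_le
  r_def p0 pS uS u_stop sf2_gt0 B_coercive.
split; first by exists (PU us); exact: solution_minimizer.
move=> n; have [l [_ /minimizersP[_ l_sol] -> l_orth]] := limit_spec us_sol.
have theta_p_eq : sin (theta_p dot U V) = tp := sin_theta_p.
set e0 := rnorm (u 0%N - l); have e0_ge0 : 0 <= e0 by exact: rnorm_ge0.
have e_sqr m : rnorm (u m - l : H) ^+ 2 = rd (u m - l) (u m - l).
  by rewrite (rdot_norm dot_norm).
have D_e m y : B y = 0 -> rd (u m - l) y = 0.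
  move=> By; rewrite -(subrKA (u 0%N)) (siDl rP) l_orth// addr0.
  exact: (cg_increment_kernel rP B_adj r_def p0 pS uS u_stop).
have BsB_le x : rd (Bs (B x)) (Bs (B x)) <= tp ^+ 2 * rd (B x) (B x).
  by have := Bs_tp (B x); rewrite /Bs /B /= Q_idem.
(* A nonzero initial error is what forces [sf <= tp]; if [U] is contained in [V], then [tp = 0] and
   [sf = 1]. For [e0 = 0] both sides vanish, as errors do not grow. *)
have [e0_eq0|e0_neq0] := eqVneq e0 0.
  rewrite e0_eq0 mulr0 -(@ler_pXn2r _ 2) ?nnegrE ?rnorm_ge0// expr0n /= e_sqr.
  have := cg_error_decrease rP definite B_lin Bs_lin B_adj
    r_def p0 pS uS u_stop l_sol (leq0n n).
  rewrite -(e_sqr 0%N) -/e0 e0_eq0 expr0n /=.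
  by have := si_ge0 rP (u n - u 0%N); lra.
have e0_gt0 : 0 < e0 by rewrite lt_neqAle eq_sym e0_neq0.
have s_le_t : sf <= tp.
  rewrite -(@ler_pXn2r _ 2) ?nnegrE ?tp_ge0 ?(ltW s_gt0)//.
  rewrite -(@ler_pM2r _ (e0 ^+ 2)) ?exprn_gt0// /e0 e_sqr.
  apply: le_trans (B_coercive (D_e 0%N)) _.
  exact: (cg_image_le rP B_adj BsB_le).
have t_gt0 : 0 < tp by exact: lt_le_trans s_le_t.
(* Both equal [(tp - sf) / (tp + sf)]; the fraction is expanded by [tp + sf] to match the Chebyshev
   bound. *)
have kappaE : 1 - 2 / (kappa + 1) = (tp ^+ 2 - sf ^+ 2) / (tp + sf) ^+ 2.
  rewrite /kappa theta_p_eq -/sf; field.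
  by rewrite !gt_eqF ?addr_gt0.
have ts_gt0 : 0 < tp + sf by rewrite addr_gt0.
have w_ge0 : 0 <= tp ^+ 2 - sf ^+ 2 by rewrite subr_ge0 ler_pXn2r// nnegrE ltW.
have q_ge0 : 0 <= (tp ^+ 2 - sf ^+ 2) / (tp + sf) ^+ 2.
  by rewrite divr_ge0 ?sqr_ge0.
(* After stopping, the error lies in the kernel of [B] and is orthogonal to it, hence is zero;
   otherwise all earlier residuals are nonzero and the rate applies. *)
have [r0|rn] := eqVneq (r n) 0.
  have -> : u n - l = 0.
    have Be : B (u n - l) = 0.
      apply: ker_BsB; rewrite (_ : B (u n - l) = (B (u n) - b) - (B l - b)).
        by rewrite (rlinD Bs_lin) (rlinN Bs_lin) l_sol -r_def r0 subrr.
      rewrite (rlinD B_lin) (rlinN B_lin); move: (B (u n)) (B l) b => y z d.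
      by rewrite opprB subrKA.
    by apply: definite; exact: D_e.
  rewrite {1}/rnorm normr0 (_ : scalar_re 0 = 0); last first.
    by rewrite /scalar_re; case: (k).
  rewrite kappaE /kappa theta_p_eq -/sf mulr_ge0// mulr_ge0 ?exprn_ge0//.
  by rewrite mulr_ge0// divr_ge0// ltW.
have rj j : (j < n)%N -> r j != 0.
  move=> jn.
  exact: (@cg_running R E B Bs b u r r_def u_stop j n (ltnW jn) rn).
have := cg_rate rP definite B_lin Bs_lin B_adj r_def p0 pS uS u_stop l_sol
  s_gt0 s_le_t B_coercive BsB_le (D_e 0%N) rj.
rewrite -!e_sqr -/e0; set en := rnorm _ => rate.
have en_ge0 : 0 <= en by exact: rnorm_ge0.
(* The square root of the rate for squared norms. *)
have {}rate : sf * ((tp + sf) ^+ 2) ^+ n * en <=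
    2 * tp * (tp ^+ 2 - sf ^+ 2) ^+ n * e0.
  rewrite -(@ler_pXn2r _ 2) ?nnegrE ?mulr_ge0 ?exprn_ge0 ?(ltW s_gt0)
    ?(ltW t_gt0) ?(ltW ts_gt0)//.
  by rewrite !(exprMn 2) -!(exprM _ n 2) mulnC -natrX.
rewrite kappaE /kappa theta_p_eq -/sf expr_div_n.
rewrite (_ : _ * e0 = (2 * tp * (tp ^+ 2 - sf ^+ 2) ^+ n * e0) /
    (sf * ((tp + sf) ^+ 2) ^+ n)).
  by rewrite ler_pdivlMr ?mulr_gt0 ?exprn_gt0// mulrC.
have : ((tp + sf) ^+ 2) ^+ n != 0 by rewrite gt_eqF// !exprn_gt0.
move: (((tp + sf) ^+ 2) ^+ n) ((tp ^+ 2 - sf ^+ 2) ^+ n) => x y x0.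
by field; rewrite x0 gt_eqF.
Qed.

End LeastSquares.

Theorem proposition7p7 (R : realType) (k : scalar_kind)
    (H : completeNormedModType (scalars R k))
    (dot : {dot H for @scalar_conj R k})
    (dot_norm : forall x : H, dot x x = `|x| ^+ 2)
    (U W V : set H)
    (closedU : closed U) (linU : linear_subspace U)
    (closedW : closed W) (affW : affine_subspace_with_direction W V)
    (u0 : H) (Uu0 : U u0)
    (u r p : nat -> H) (cg : cg_iteration dot U W V u0 u r p) :
  let M := minimizers dot U W in
  let theta_f := friedrichs_angle dot U V in
  let kappa := sin (theta_p dot U V) / sin theta_f in
  [/\ M !=set0 -> u @ \oo --> orth_proj dot M u0,
      M = set0 -> (fun n => rnorm (u n)) @ \oo --> +oo
    & 0 < theta_f ->
      M !=set0 /\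
      forall n : nat,
        rnorm (u n - orth_proj dot M u0) <=
        2 * kappa * (1 - 2 / (kappa + 1)) ^+ n * rnorm (u 0%N - orth_proj dot M u0)].
Proof.
have [V_lin [w W_def]] := affW.
have U_closed := closed_seq_closed dot_norm closedU.
(* Closedness passes from [W] to its translate [V]. *)
have V_closed : seq_closed dot V.
  move=> x l Vx xl.
  have Wl : W (w + l).
    apply: (closed_seq_closed dot_norm closedW (x := fun n => w + x n)) => [n|].
      by rewrite W_def; exists (x n).
    rewrite /si_cvg; under eq_fun do rewrite opprD addrACA subrr add0r.
    exact: xl.
  by move: Wl; rewrite W_def => -[v Vv /addrI <-].
move=> M theta_f kappa; split.
- exact: (cg_iteration_cvg dot_norm linU U_closed V_lin V_closed W_def Uu0 cg).
- exact: (cg_iteration_diverge dot_norm linU U_closed V_lin V_closed W_def Uu0 cg).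
- exact: (cg_iteration_rate dot_norm linU U_closed V_lin V_closed W_def Uu0 cg).
Qed.
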